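(* Let $E\subseteq B(H)$ be a unital operator system with the completely positive approximation property (CPAP) such that $E$ is not (isomorphic as an operator system to) a C*-algebra. Then the operator system $$E\otimes c_0(\mathbb{N}):=\overline{\operatorname{span}}\{x\otimes f:x\in E,\ f\in c_0(\mathbb{N})\}\subseteq B(H\otimes\ell^2(\mathbb{N}))$$ has the CPAP but is not (isomorphic as an operator system to) a C*-algebra.
   Context: An operator system is a norm-closed subspace $E \subseteq B(H)$ ($H$ a Hilbert space) closed under the adjoint; it need not contain the unit of $B(H)$, and is unital if it contains $1\in B(H)$. $M_d(E)\subseteq B(H^d)$ carries the inherited norm and positive cone. Isomorphisms of operator systems are linear bijections that are completely isometric and such that the map and its inverse are completely positive. $c_0(\mathbb{N})$ acts on $\ell^2(\mathbb{N})$ by multiplication (diagonal) operators. An operator system $E$ has the CPAP if there is a net of completely positive and completely contractive maps $\psi_i:E\to M_{n_i}$ and $\phi_i:M_{n_i}\to E$, $n_i\ge1$, such that $\phi_i\circ\psi_i\to\mathrm{id}_E$ in the point-norm topology. *)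

(* Defs.v *)
From HB Require Import structures.
From mathcomp Require Import all_boot all_order all_algebra.
From mathcomp Require Import boolp classical_sets functions reals topology.
From mathcomp Require Import normedtype sequences complex ring lra.

Set Implicit Arguments.
Unset Strict Implicit.
Unset Printing Implicit Defensive.

Import Order.TTheory GRing.Theory Num.Theory.
Import numFieldNormedType.Exports.

Local Open Scope classical_set_scope.
Local Open Scope ring_scope.

(* Complex Hilbert spaces; the complex numbers are R[i] for a model R of the
   real numbers. The inner product is linear in its first argument. *)
HB.mixin Record NormedModule_isHilbert (R : realType) H
    of NormedModule R[i] H := {
  hdot : H -> H -> R[i];
  hdot_linearl : forall y, scalar (hdot^~ y);
  hdotC : forall x y, hdot x y = (hdot y x)^*;
  hdot_norm : forall x, hdot x x = `|x| ^+ 2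
}.

#[short(type="hilbertType")]
HB.structure Definition Hilbert (R : realType) :=
  {H of CompleteNormedModule R[i] H & NormedModule_isHilbert R H}.

(* An inner product on a complex vector space, complete for the norm
   sqrt (f x x), yields a Hilbert space (Lmodule_isHilbert below). *)
Section PreHilbert.
Context (R : realType) (H : lmodType R[i]) (f : H -> H -> R[i]).
Hypotheses (f_linear : forall y, scalar (f^~ y)).
Hypotheses (f_conj : forall x y, f x y = (f y x)^*).
Hypotheses (f_ge0 : forall x, 0 <= f x x).
Hypotheses (f_eq0 : forall x, f x x = 0 -> x = 0).

Lemma pre_dotDl x y z : f (x + y) z = f x z + f y z.
Proof. by have := f_linear z 1 x y; rewrite scale1r mul1r. Qed.

Lemma pre_dot0l z : f 0 z = 0.
Proof. by apply: (addrI (f 0 z)); rewrite -pre_dotDl !addr0. Qed.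

Lemma pre_dotZl a x z : f (a *: x) z = a * f x z.
Proof. by have := f_linear z a x 0; rewrite !addr0 pre_dot0l addr0. Qed.

Lemma pre_dotDr x y z : f x (y + z) = f x y + f x z.
Proof. by rewrite f_conj pre_dotDl rmorphD /= -!f_conj. Qed.

Lemma pre_dotZr a x z : f x (a *: z) = a^* * f x z.
Proof. by rewrite f_conj pre_dotZl rmorphM /= -!f_conj. Qed.

Lemma pre_CauchySchwarz x y : `|f x y| ^+ 2 <= f x x * f y y.
Proof.
have [y0|y0] := eqVneq (f y y) 0.
  by rewrite (f_eq0 y0) f_conj pre_dot0l conjC0 normr0 expr0n /= pre_dot0l mulr0.
have yp : 0 < f y y by rewrite lt_neqAle eq_sym y0 f_ge0.
have yr : (f y y)^* = f y y by rewrite -f_conj.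
have yx : f y x = (f x y)^* by rewrite -f_conj.
have := f_ge0 (x - (f x y / f y y) *: y).
rewrite -scaleNr pre_dotDl !pre_dotDr pre_dotZr !pre_dotZl pre_dotZr yx.
rewrite !rmorphN rmorphM fmorphV /= yr.
have -> : f x x + - ((f x y)^* / f y y) * f x y +
  (- (f x y / f y y) * (f x y)^* +
   - (f x y / f y y) * (- ((f x y)^* / f y y) * f y y))
  = f x x - `|f x y| ^+ 2 / f y y.
  by rewrite normCK; field.
by rewrite subr_ge0 ler_pdivrMr.
Qed.

Definition pre_norm x := sqrtC (f x x).

Lemma pre_normD x y : pre_norm (x + y) <= pre_norm x + pre_norm y.
Proof.
have nn z : 0 <= pre_norm z by rewrite sqrtC_ge0.
rewrite -(@ler_pXn2r _ 2) ?nnegrE ?addr_ge0 // sqrrD !sqrtCK.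
rewrite pre_dotDl !pre_dotDr.
rewrite (_ : _ + _ = f x x + f y y + (f x y + f y x)); last by ring.
rewrite [leRHS](_ : _ = f x x + f y y + pre_norm x * pre_norm y *+ 2);
  last by ring.
rewrite lerD2l (f_conj y x).
have -> : f x y + (f x y)^* = 'Re (f x y) *+ 2.
  by rewrite ReE -[RHS]mulr_natr divfK // pnatr_eq0.
rewrite ler_pMn2r //.
apply: (@le_trans _ _ `|f x y|).
  by have [] := leif_Re_Creal (f x y).
rewrite -(@ler_pXn2r _ 2) ?nnegrE ?mulr_ge0 // exprMn !sqrtCK.
exact: pre_CauchySchwarz.
Qed.

Lemma pre_normZ a x : pre_norm (a *: x) = `|a| * pre_norm x.
Proof.
rewrite /pre_norm pre_dotZl pre_dotZr mulrA -normCK.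
by rewrite rootCMl ?exprn_ge0 // sqrCK.
Qed.

Lemma pre_norm_eq0 x : pre_norm x = 0 -> x = 0.
Proof. by move/eqP; rewrite sqrtC_eq0 => /eqP/f_eq0. Qed.

End PreHilbert.

Lemma complex_invS_lt (K : realType) (e : K[i]) : 0 < e ->
  exists N, forall n, (N <= n)%N -> n.+1%:R^-1 < e.
Proof.
move=> e0; have /complex_realP[r er] : e \is Num.real by exact: gtr0_real.
move: e0; rewrite er ltcR => r0.
exists (Num.truncn r^-1) => n Nn.
rewrite -(rmorph_nat (real_complex K)) -fmorphV ltcR.
rewrite invf_plt ?posrE // (lt_le_trans (truncnS_gt _)) // ler_nat.
by rewrite ltnS.
Qed.

Lemma seq_complete (K : realType) (V : normedModType K[i]) :
  (forall u : nat -> V,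
    (forall e : K[i], 0 < e -> exists N, forall m n, (N <= m)%N -> (N <= n)%N ->
       `|u m - u n| < e) ->
    exists l : V, forall e : K[i], 0 < e ->
      exists N, forall n, (N <= n)%N -> `|u n - l| < e) ->
  forall F : set_system V, ProperFilter F -> cauchy F -> cvg F.
Proof.
move=> sc F FF /cauchyP Fc.
pose d n : K[i] := (n.+1%:R)^-1.
have d0 n : 0 < d n by rewrite invr_gt0 ltr0n.
have dlim e : 0 < e -> exists N, forall n, (N <= n)%N -> d n < e.
  exact: complex_invS_lt.
have /choice[u Fu] : forall n, exists x, F (ball x (d n)).
  by move=> n; exact: Fc.
have uu m n : `|u m - u n| < d m + d n.
  have [z [zm zn]] := @filter_ex _ F FF _ (filterI (Fu m) (Fu n)).
  rewrite -(subrKA z) (le_lt_trans (ler_normD _ _)) // ltrD //.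
    by move: zm; rewrite -ball_normE.
  by move: zn; rewrite -ball_normE /= distrC.
have [|l ul] := sc u.
  move=> e e0; have [N dN] := dlim (e / 2) (divr_gt0 e0 (ltr0Sn _ _)).
  exists N => m n Nm Nn; rewrite (lt_trans (uu _ _)) //.
  by rewrite (splitr e) ltrD ?dN.
apply/cvg_ex; exists l; apply/cvgrPdist_lt => e e0.
have e2 : 0 < e / 2 by rewrite divr_gt0 // ltr0Sn.
have [N1 dN] := dlim _ e2; have [N2 uN] := ul _ e2.
pose n := maxn N1 N2.
apply: filterS (Fu n) => x; rewrite -ball_normE /= => ux.
rewrite -(subrKA (u n)) (le_lt_trans (ler_normD _ _)) //.
rewrite (splitr e) ltrD //; first by rewrite distrC uN // leq_maxr.
by rewrite (lt_trans ux) // dN // leq_maxl.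
Qed.

HB.factory Record Lmodule_isHilbert (R : realType) H of GRing.Lmodule R[i] H := {
  dot : H -> H -> R[i];
  dot_linearl : forall y, scalar (dot^~ y);
  dotC : forall x y, dot x y = (dot y x)^*;
  dot_ge0 : forall x, 0 <= dot x x;
  dot_eq0 : forall x, dot x x = 0 -> x = 0;
  dot_complete : forall u : nat -> H,
    (forall e : R[i], 0 < e -> exists N, forall m n, (N <= m)%N -> (N <= n)%N ->
       dot (u m - u n) (u m - u n) < e) ->
    exists l : H, forall e : R[i], 0 < e ->
      exists N, forall n, (N <= n)%N -> dot (u n - l) (u n - l) < e
}.

HB.builders Context R H of Lmodule_isHilbert R H.

Let normD x y : pre_norm dot (x + y) <= pre_norm dot x + pre_norm dot y.
Proof.
by apply: pre_normD;
  [exact: dot_linearl | exact: dotC | exact: dot_ge0 | exact: dot_eq0].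
Qed.

Let normZ a x : pre_norm dot (a *: x) = `|a| * pre_norm dot x.
Proof. by apply: pre_normZ; [exact: dot_linearl | exact: dotC]. Qed.

Let norm_eq0 x : pre_norm dot x = 0 -> x = 0.
Proof. exact: pre_norm_eq0 dot_eq0 _. Qed.

HB.instance Definition _ := Lmodule_isNormed.Build R[i] H normD normZ norm_eq0.

Let dot_norm x : dot x x = `|x| ^+ 2.
Proof. by rewrite [LHS](esym (sqrtCK _)). Qed.

Let complete : forall F : set_system H, ProperFilter F -> cauchy F -> cvg F.
Proof.
apply: seq_complete => u uc.
have [|l ul] := @dot_complete u.
  move=> e e0; have [|N uN] := uc (sqrtC e); first by rewrite sqrtC_gt0.
  exists N => m n Nm Nn; rewrite dot_norm -[e]sqrtCK ltr_pXn2r ?nnegrE //.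
    exact: uN.
  by rewrite sqrtC_ge0 ltW.
exists l => e e0; have [|N uN] := ul (e ^+ 2); first by rewrite exprn_gt0.
exists N => n Nn; rewrite -(@ltr_pXn2r _ 2) ?nnegrE ?(ltW e0) // -dot_norm.
exact: uN.
Qed.

HB.instance Definition _ := Uniform_isComplete.Build H complete.

HB.instance Definition _ :=
  NormedModule_isHilbert.Build R H dot_linearl dotC dot_norm.

HB.end.

Section HilbertTheory.
Context (R : realType) (H : hilbertType R).
Implicit Types x y z : H.

Lemma hdotDl x y z : hdot (x + y) z = hdot x z + hdot y z.
Proof. exact: pre_dotDl (@hdot_linearl R H) _ _ _. Qed.

Lemma hdotZl a x z : hdot (a *: x) z = a * hdot x z.
Proof. exact: pre_dotZl (@hdot_linearl R H) _ _ _. Qed.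

Lemma hdotDr x y z : hdot x (y + z) = hdot x y + hdot x z.
Proof. exact: pre_dotDr (@hdot_linearl R H) (@hdotC R H) _ _ _. Qed.

Lemma hdotZr a x z : hdot x (a *: z) = a^* * hdot x z.
Proof. exact: pre_dotZr (@hdot_linearl R H) (@hdotC R H) _ _ _. Qed.

Lemma hdot0l z : hdot 0 z = 0.
Proof. exact: pre_dot0l (@hdot_linearl R H) _. Qed.

Lemma hdot0r z : hdot z 0 = 0.
Proof. by rewrite hdotC hdot0l conjC0. Qed.

Lemma hdotNl x z : hdot (- x) z = - hdot x z.
Proof. by rewrite -scaleN1r hdotZl mulN1r. Qed.

Lemma hdotNr x z : hdot x (- z) = - hdot x z.
Proof. by rewrite hdotC hdotNl rmorphN /= -hdotC. Qed.

Lemma hdotBl x y z : hdot (x - y) z = hdot x z - hdot y z.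
Proof. by rewrite hdotDl hdotNl. Qed.

Lemma hdotBr x y z : hdot x (y - z) = hdot x y - hdot x z.
Proof. by rewrite hdotDr hdotNr. Qed.

Lemma hdot_suml I (r : seq I) (P : pred I) (F : I -> H) z :
  hdot (\sum_(i <- r | P i) F i) z = \sum_(i <- r | P i) hdot (F i) z.
Proof.
by apply: (big_morph (hdot^~ z)); [move=> x y; exact: hdotDl | exact: hdot0l].
Qed.

Lemma hdot_sumr I (r : seq I) (P : pred I) (F : I -> H) z :
  hdot z (\sum_(i <- r | P i) F i) = \sum_(i <- r | P i) hdot z (F i).
Proof.
by apply: (big_morph (hdot z)); [move=> x y; exact: hdotDr | exact: hdot0r].
Qed.

Lemma hdot_ge0 x : 0 <= hdot x x.
Proof. by rewrite hdot_norm exprn_ge0. Qed.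

Lemma hdot_eq0 x : hdot x x = 0 -> x = 0.
Proof. by move/eqP; rewrite hdot_norm sqrf_eq0 normr_eq0 => /eqP. Qed.

Lemma hdot_CauchySchwarz x y : `|hdot x y| <= `|x| * `|y|.
Proof.
rewrite -(@ler_pXn2r _ 2) ?nnegrE ?mulr_ge0 // exprMn -!hdot_norm.
exact: pre_CauchySchwarz (@hdot_linearl R H) (@hdotC R H) hdot_ge0 hdot_eq0 _ _.
Qed.

Lemma eq_hdotl x y : (forall z, hdot x z = hdot y z) -> x = y.
Proof.
move=> xy; apply/eqP; rewrite -subr_eq0; apply/eqP/hdot_eq0.
by rewrite hdotBl xy subrr.
Qed.

Lemma hilbert_cauchy_seq (u : nat -> H) :
  (forall e : R[i], 0 < e -> exists N, forall m n, (N <= m)%N -> (N <= n)%N ->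
     `|u m - u n| < e) ->
  exists l : H, forall e : R[i], 0 < e ->
    exists N, forall n, (N <= n)%N -> `|u n - l| < e.
Proof.
move=> uc; have /cauchy_cvg/cvg_ex[l ul] : cauchy (u @ \oo).
  apply/cauchyP => e /uc[N uN]; exists (u N); exists N => // n /= Nn.
  by rewrite -ball_normE /=; exact: uN.
exists l => e e0; have /cvgrPdist_lt/(_ e e0)[N _ uN] := ul.
by exists N => n Nn; rewrite distrC; exact: uN.
Qed.

End HilbertTheory.

(* The complex numbers as a one-dimensional Hilbert space. The alias is needed
   because MathComp-Analysis already registers completeness of R^o for real R. *)
Definition cline (R : realType) : Type := R[i]^o.

Section Scalars.
Context (R : realType).
Local Notation cline := (cline R).
Local Notation C := (R[i]^o).
Local Notation Re := (@complex.Re R).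
Local Notation Im := (@complex.Im R).

Lemma normc_ge_Im (z : R[i]) : `|Im z|%:C%C <= `|z|.
Proof.
rewrite -[Im z]opprK -ReiNIm normrN (le_trans (normc_ge_Re _)) // normrM.
by rewrite complexiE normCi mulr1.
Qed.

Lemma real_cauchy_seq (u : nat -> R) :
  (forall e : R, 0 < e -> exists N, forall m n, (N <= m)%N -> (N <= n)%N ->
     `|u m - u n| < e) ->
  exists l : R, forall e : R, 0 < e ->
    exists N, forall n, (N <= n)%N -> `|u n - l| < e.
Proof.
move=> uc; have /cauchy_cvg/cvg_ex[l ul] : cauchy (u @ \oo).
  apply/cauchyP => e /uc[N uN]; exists (u N); exists N => // n /= Nn.
  by rewrite -ball_normE /=; exact: uN.
exists l => e e0; have /cvgrPdist_lt/(_ e e0)[N _ uN] := ul.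
by exists N => n Nn; rewrite distrC; exact: uN.
Qed.

Lemma complex_cauchy_seq (u : nat -> C) :
  (forall e : R[i], 0 < e -> exists N, forall m n, (N <= m)%N -> (N <= n)%N ->
     `|u m - u n| < e) ->
  exists l : C, forall e : R[i], 0 < e ->
    exists N, forall n, (N <= n)%N -> `|u n - l| < e.
Proof.
move=> uc.
have ReB (x y : R[i]) : Re (x - y) = Re x - Re y by case: x; case: y.
have ImB (x y : R[i]) : Im (x - y) = Im x - Im y by case: x; case: y.
have [a ua] : exists l : R, forall e : R, 0 < e ->
    exists N, forall n, (N <= n)%N -> `|Re (u n) - l| < e.
  apply: real_cauchy_seq => e e0; have [|N uN] := uc e%:C%C; first by rewrite ltcR.
  exists N => m n Nm Nn; rewrite -ltcR -ReB.
  by rewrite (le_lt_trans (normc_ge_Re _)) // uN.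
have [b ub] : exists l : R, forall e : R, 0 < e ->
    exists N, forall n, (N <= n)%N -> `|Im (u n) - l| < e.
  apply: real_cauchy_seq => e e0; have [|N uN] := uc e%:C%C; first by rewrite ltcR.
  exists N => m n Nm Nn; rewrite -ltcR -ImB.
  by rewrite (le_lt_trans (normc_ge_Im _)) // uN.
exists (a +i* b)%C => e e0.
have /complex_realP[r er] : e \is Num.real by exact: gtr0_real.
have r0 : 0 < r / 2 by move: e0; rewrite er ltcR => r0; rewrite divr_gt0.
have [N1 N1P] := ua _ r0; have [N2 N2P] := ub _ r0.
exists (maxn N1 N2) => n; rewrite geq_max => /andP[n1 n2].
rewrite [u n - _]complexE ReB ImB (le_lt_trans (ler_normD _ _)) //.
have nR (x : R) : `|x%:C%C| = `|x|%:C%C.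
  by rewrite normc_def /= expr0n addr0 sqrtr_sqr.
rewrite normrM complexiE normCi mul1r er !nR -rmorphD ltcR (splitr r) ltrD //.
  exact: N1P.
exact: N2P.
Qed.

HB.instance Definition _ := NormedModule.copy cline C.
HB.instance Definition _ :=
  Uniform_isComplete.Build cline (seq_complete complex_cauchy_seq).

Definition cdot (x y : cline) : R[i] := x * y^*.

Lemma cdot_linearl (y : cline) : scalar (cdot^~ y).
Proof. by move=> a x z; rewrite /cdot mulrDl -mulrA. Qed.

Lemma cdotC (x y : cline) : cdot x y = (cdot y x)^*.
Proof. by rewrite /cdot rmorphM /= conjCK mulrC. Qed.

Lemma cdot_norm (x : cline) : cdot x x = `|x| ^+ 2.
Proof. by rewrite /cdot -normCK. Qed.

HB.instance Definition _ :=
  NormedModule_isHilbert.Build R cline cdot_linearl cdotC cdot_norm.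

End Scalars.

(* The Hilbert space direct sum H^d. *)
Definition hpow (R : realType) (H : hilbertType R) (d : nat) :=
  {ffun 'I_d -> H}.

Section HilbertPower.
Context (R : realType) (H : hilbertType R) (d : nat).
Local Notation Hd := (hpow H d).

HB.instance Definition _ := GRing.Lmodule.copy Hd {ffun 'I_d -> H}.

Definition hpow_dot (x y : Hd) : R[i] := \sum_i hdot (x i) (y i).

Lemma hpow_dot_linearl y : scalar (hpow_dot^~ y).
Proof.
move=> a x z; rewrite /hpow_dot mulr_sumr -big_split /=.
by apply: eq_bigr => i _; rewrite !ffunE hdotDl hdotZl.
Qed.

Lemma hpow_dotC x y : hpow_dot x y = (hpow_dot y x)^*.
Proof.
rewrite /hpow_dot rmorph_sum /=; apply: eq_bigr => i _; exact: hdotC.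
Qed.

Lemma hpow_dot_ge0 x : 0 <= hpow_dot x x.
Proof. by apply: sumr_ge0 => i _; exact: hdot_ge0. Qed.

Lemma hpow_dot_eq0 x : hpow_dot x x = 0 -> x = 0.
Proof.
move=> /eqP; rewrite psumr_eq0 => [|i _]; last exact: hdot_ge0.
move=> /allP x0; apply/ffunP => i; rewrite ffunE; apply: hdot_eq0.
by apply/eqP/x0; rewrite mem_index_enum.
Qed.

Lemma hpow_dot_complete (u : nat -> Hd) :
  (forall e : R[i], 0 < e -> exists N, forall m n, (N <= m)%N -> (N <= n)%N ->
     hpow_dot (u m - u n) (u m - u n) < e) ->
  exists l : Hd, forall e : R[i], 0 < e ->
    exists N, forall n, (N <= n)%N -> hpow_dot (u n - l) (u n - l) < e.
Proof.
move=> uc.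
have /choice[l ul] : forall i, exists l : H, forall e : R[i], 0 < e ->
    exists N, forall n, (N <= n)%N -> `|u n i - l| < e.
  move=> i; apply: hilbert_cauchy_seq => e e0.
  have [|N uN] := uc (e ^+ 2); first by rewrite exprn_gt0.
  exists N => m n Nm Nn; rewrite -(@ltr_pXn2r _ 2) ?nnegrE ?(ltW e0) //.
  rewrite -hdot_norm (le_lt_trans _ (uN m n Nm Nn)) // /hpow_dot (bigD1 i) //=.
  rewrite !ffunE lerDl; apply: sumr_ge0 => j _; exact: hdot_ge0.
exists [ffun i => l i] => e e0.
pose e' := sqrtC (e / d.+1%:R).
have e'0 : 0 < e' by rewrite sqrtC_gt0 divr_gt0 // ltr0n.
have /choice[N uN] : forall i, exists N, forall n, (N <= n)%N ->
  `|u n i - l i| < e' by move=> i; exact: ul.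
exists (\max_i N i) => n Nn.
rewrite (@le_lt_trans _ _ (\sum_(i < d) e / d.+1%:R)) //.
  apply: ler_sum => i _; rewrite !ffunE hdot_norm -[leRHS]sqrtCK.
  rewrite ler_pXn2r ?nnegrE ?(ltW e'0) // ltW // uN //.
  by rewrite (leq_trans _ Nn) // leq_bigmax.
rewrite sumr_const card_ord -[_ *+ d]mulr_natr -mulrA gtr_pMr //.
by rewrite mulrC ltr_pdivrMr ?ltr0n // mul1r ltr_nat.
Qed.

HB.instance Definition _ := Lmodule_isHilbert.Build R Hd
  hpow_dot_linearl hpow_dotC hpow_dot_ge0 hpow_dot_eq0 hpow_dot_complete.

End HilbertPower.

Section ComplexSequences.
Context (R : realType).
Local Notation C := (R[i]^o).

Lemma complex_lim_ge0 (s : nat -> C) (l : C) N :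
  s @ \oo --> l -> (forall n, (N <= n)%N -> 0 <= (s n : R[i])) -> 0 <= (l : R[i]).
Proof.
move=> sl s0.
have ns : (fun n => `|s n| : C) @ \oo --> (`|l| : C) by exact: cvg_norm.
have ns' : s @ \oo --> (`|l| : C).
  apply: cvg_trans ns; apply: near_eq_cvg; exists N => // n /= Nn.
  by rewrite ger0_norm // s0.
have -> : l = `|l| by exact: (cvg_unique _ sl ns').
exact: normr_ge0.
Qed.

Lemma complex_lim_le (s : nat -> C) (l M : C) N :
  s @ \oo --> l -> (forall n, (N <= n)%N -> (s n : R[i]) <= M) -> (l : R[i]) <= M.
Proof.
move=> sl sM; rewrite -subr_ge0.
apply: (@complex_lim_ge0 (fun n => M - s n) _ N).
  exact: (@cvgB _ C _ _ _ (fun=> M) s M l (cvg_cst M) sl).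
by move=> n Nn; rewrite subr_ge0 sM.
Qed.

Lemma complex_lim_ge (s : nat -> C) (l M : C) N :
  s @ \oo --> l -> (forall n, (N <= n)%N -> (M : R[i]) <= s n) -> (M : R[i]) <= l.
Proof.
move=> sl sM; rewrite -subr_ge0.
apply: (@complex_lim_ge0 (fun n => s n - M) _ N).
  exact: (@cvgB _ C _ _ _ s (fun=> M) l M sl (cvg_cst M)).
by move=> n Nn; rewrite subr_ge0 sM.
Qed.

Lemma cvg_conjc (s : nat -> C) (l : C) : s @ \oo --> l ->
  (fun n => (s n)^* : C) @ \oo --> (l^* : C).
Proof.
move=> /cvgrPdist_lt sl; apply/cvgrPdist_lt => e /sl; apply: filterS => n /=.
by rewrite -[in X in _ -> X]rmorphB /= norm_conjC.
Qed.

Lemma bounded_series_cvg (a : nat -> C) (M : R[i]) :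
  (forall n, \sum_(k < n) `|a k| <= M) -> cvgn (series a).
Proof.
move=> aM; pose s n : R := complex.Re (\sum_(k < n) `|a k|).
have sE n : (s n)%:C%C = \sum_(k < n) `|a k|.
  by apply: RRe_real; apply: sum_real => i _; exact: normr_real.
have sB m n : (m <= n)%N -> (s n - s m)%:C%C = \sum_(m <= k < n) `|a k|.
  move=> mn; rewrite rmorphB /= !sE -!(big_mkord xpredT (fun k => `|a k|)).
  by rewrite (big_cat_nat (leq0n m) mn) /= addrAC subrr add0r.
have nd : nondecreasing_seq s.
  move=> m n mn; rewrite -subr_ge0 -ler0c sB //.
  by apply: sumr_ge0 => i _; exact: normr_ge0.
have /cvg_ex[l sl] : cvgn s.
  apply: nondecreasing_is_cvgn => //; exists (complex.Re M) => _ [n _ <-].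
  have := aM n; rewrite -sE lecE /= => /andP[_]; exact.
have key m n : (m <= n)%N -> `|series a n - series a m| <= (s n - s m)%:C%C.
  move=> mn; rewrite sB // sub_series_geq //; exact: ler_norm_sum.
have [|z az] := @complex_cauchy_seq R (series a).
  move=> e e0; have /complex_realP[r er] : e \is Num.real by exact: gtr0_real.
  have r0 : 0 < r / 2 by move: e0; rewrite er ltcR => r0; rewrite divr_gt0.
  have /cvgrPdist_lt/(_ _ r0)[N _ Nl] := sl.
  exists N => m n Nm Nn; wlog mn : m n Nm Nn / (m <= n)%N.
    move=> wl; case/orP: (leq_total m n) => ?; first exact: wl.
    by rewrite distrC; exact: wl.
  rewrite distrC (le_lt_trans (key _ _ mn)) // er ltcR (le_lt_trans (ler_norm _)) //.
  rewrite -(subrKA l) (le_lt_trans (ler_normD _ _)) // (splitr r) ltrD //.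
    by rewrite distrC; exact: Nl.
  exact: Nl.
apply/cvg_ex; exists z; apply/cvgrPdist_lt => e /az[N Nz].
by exists N => // n /= Nn; rewrite distrC; exact: Nz.
Qed.

Lemma cvg_ord_sum (f : nat -> nat -> C) (a : nat -> C) K :
  (forall k, (fun n => f n k) @ \oo --> a k) ->
  (fun n => \sum_(k < K) f n k) @ \oo --> \sum_(k < K) a k.
Proof.
move=> fa; elim: K => [|K IH].
  rewrite big_ord0 (_ : (fun _ => _) = (fun=> 0)); first exact: cvg_cst.
  by apply/funext => n; rewrite big_ord0.
rewrite big_ord_recr (_ : (fun _ => _) =
    (fun n => \sum_(k < K) f n k + f n K)); first exact: (cvgD IH (fa K)).
by apply/funext => n; rewrite big_ord_recr.
Qed.

End ComplexSequences.

Section HilbertSequences.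
Context (R : realType) (H : hilbertType R).
Local Notation C := (R[i]^o).
Implicit Types x y : nat -> H.

(* sum_k |x k|^2 < oo; the partial sums are nondecreasing, so convergence is
   the existence of an upper bound. *)
Definition square_summable x : Prop :=
  exists M : R[i], forall n, \sum_(k < n) `|x k| ^+ 2 <= M.

Definition l2_pred : {pred nat -> H} := fun x => `[< square_summable x >].

Lemma l2_predP x : reflect (square_summable x) (x \in l2_pred).
Proof. exact: asboolP. Qed.

Lemma l2_submod_closed : submod_closed l2_pred.
Proof.
split=> [|a x y /l2_predP[Mx xM] /l2_predP[My yM]]; apply/l2_predP.
  by exists 0 => n; rewrite big1 // => k _; rewrite normr0 expr0n.
exists ((`|a| ^+ 2 * Mx + My) *+ 2) => n.
apply: (@le_trans _ _ ((`|a| ^+ 2 * (\sum_(k < n) `|x k| ^+ 2) +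
    \sum_(k < n) `|y k| ^+ 2) *+ 2)).
  rewrite mulr_sumr -big_split /= -sumrMnl; apply: ler_sum => k _.
  rewrite -exprMn -normrZ.
  set u := a *: x k; set v := y k.
  have -> : (a *: x + y) k = u + v by [].
  rewrite (@le_trans _ _ ((`|u| + `|v|) ^+ 2)) //.
    by rewrite ler_pXn2r ?nnegrE ?addr_ge0 // ler_normD.
  rewrite -subr_ge0 (_ : _ - _ = (`|u| - `|v|) ^+ 2); last by ring.
  by rewrite real_exprn_even_ge0 // rpredB // normr_real.
by rewrite lerMn2r /=; apply: lerD; [apply: ler_wpM2l; [exact: exprn_ge0|exact: xM]|exact: yM].
Qed.

HB.instance Definition _ :=
  GRing.isSubmodClosed.Build R[i] (nat -> H) l2_pred l2_submod_closed.

(* The space of square-summable sequences in H. It is l^2(N) for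
   H := cline R, and the Hilbert space tensor product of H with l^2(N) in
   general: see etens, hdot_etens and etens_total. *)
Record l2 := L2 { l2_val :> nat -> H; _ : l2_val \in l2_pred }.

HB.instance Definition _ := [isSub for l2_val].
HB.instance Definition _ := [Choice of l2 by <:].
HB.instance Definition _ := [SubChoice_isSubLmodule of l2 by <:].

Lemma l2P (x : l2) : square_summable x.
Proof. by apply/l2_predP; exact: (valP x). Qed.

Lemma l2_ext (x y : l2) : (forall n, x n = y n) -> x = y.
Proof. by move=> xy; apply: val_inj; apply/funext. Qed.

Lemma l2_linE (a : R[i]) (x y : l2) n : (a *: x + y) n = a *: x n + y n.
Proof. by []. Qed.

Lemma l2_subE (x y : l2) n : (x - y) n = x n - y n.
Proof. by []. Qed.

Definition l2_dot (x y : l2) : R[i] :=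
  limn (series (fun n => hdot (x n) (y n) : C)).

Lemma is_cvg_l2_dot (x y : l2) : cvgn (series (fun n => hdot (x n) (y n) : C)).
Proof.
have [Mx xM] := l2P x; have [My yM] := l2P y.
apply: (@bounded_series_cvg _ _ (Mx + My)) => n.
apply: le_trans (lerD (xM n) (yM n)); rewrite -big_split /=.
apply: ler_sum => k _; rewrite (le_trans (hdot_CauchySchwarz _ _)) //.
rewrite -subr_ge0.
rewrite (_ : _ - _ = (`|x k| - `|y k|) ^+ 2 + `|x k| * `|y k|); last by ring.
apply: addr_ge0; last exact: mulr_ge0.
by rewrite real_exprn_even_ge0 // rpredB // normr_real.
Qed.

Lemma l2_dot_cvg (x y : l2) :
  series (fun n => hdot (x n) (y n) : C) @ \oo --> (l2_dot x y : C).
Proof. exact: is_cvg_l2_dot. Qed.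
Arguments l2_dot_cvg x y : clear implicits.

Lemma l2_dotP (x y : l2) (l : C) :
  series (fun n => hdot (x n) (y n) : C) @ \oo --> l -> l2_dot x y = l.
Proof. by move=> xyl; exact: (cvg_unique _ (l2_dot_cvg x y) xyl). Qed.

Lemma l2_dot_linearl (y : l2) : scalar (l2_dot^~ y).
Proof.
move=> a x z; apply: l2_dotP.
rewrite (_ : series _ = (fun n => a *: (series (fun k => hdot (x k) (y k) : C) n)
    + series (fun k => hdot (z k) (y k) : C) n)); last first.
  apply/funext => n; rewrite !seriesEord /= scaler_sumr -big_split /=.
  by apply: eq_bigr => k _; rewrite [LHS](hdot_linearl (y k) a (x k) (z k)).
by apply: cvgD; [apply: cvgZl_tmp|]; exact: l2_dot_cvg.
Qed.

Lemma l2_dotC (x y : l2) : l2_dot x y = (l2_dot y x)^*.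
Proof.
apply: l2_dotP.
rewrite (_ : series _ = (fun n => (series (fun k => hdot (y k) (x k) : C) n)^*)).
  exact: cvg_conjc (l2_dot_cvg _ _).
apply/funext => n; rewrite !seriesEord /= rmorph_sum /=.
by apply: eq_bigr => k _; exact: hdotC.
Qed.

Lemma l2_dot_partial (x : l2) n :
  series (fun k => hdot (x k) (x k) : C) n = \sum_(k < n) `|x k| ^+ 2 :> R[i].
Proof. by rewrite seriesEord; apply: eq_bigr => k _; exact: hdot_norm. Qed.

Lemma l2_dot_le (x : l2) (M : R[i]) :
  (forall n, \sum_(k < n) `|x k| ^+ 2 <= M) -> l2_dot x x <= M.
Proof.
move=> xM; apply: (complex_lim_le (N := 0) (l2_dot_cvg x x)) => n _.
by rewrite l2_dot_partial.
Qed.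

Lemma l2_dot_ge (x : l2) n : \sum_(k < n) `|x k| ^+ 2 <= l2_dot x x.
Proof.
apply: (complex_lim_ge (N := n) (l2_dot_cvg x x)) => m nm.
rewrite l2_dot_partial -!(big_mkord xpredT (fun k => `|x k| ^+ 2)).
rewrite (big_cat_nat (leq0n n) nm) /= lerDl.
by apply: sumr_ge0 => k _; exact: exprn_ge0.
Qed.

Lemma l2_dot_coord (x : l2) n : `|x n| ^+ 2 <= l2_dot x x.
Proof.
apply: le_trans (l2_dot_ge x n.+1); rewrite big_ord_recr /= lerDr.
by apply: sumr_ge0 => k _; exact: exprn_ge0.
Qed.

Lemma l2_dot_ge0 (x : l2) : 0 <= l2_dot x x.
Proof. by apply: le_trans (l2_dot_coord x 0%N); exact: exprn_ge0. Qed.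

Lemma l2_dot_eq0 (x : l2) : l2_dot x x = 0 -> x = 0.
Proof.
move=> x0; apply: l2_ext => n; apply/eqP; rewrite -normr_eq0 -sqrf_eq0.
by rewrite eq_le exprn_ge0 // andbT -x0; exact: l2_dot_coord.
Qed.

Lemma l2_dot_complete (u : nat -> l2) :
  (forall e : R[i], 0 < e -> exists N, forall m n, (N <= m)%N -> (N <= n)%N ->
     l2_dot (u m - u n) (u m - u n) < e) ->
  exists l : l2, forall e : R[i], 0 < e ->
    exists N, forall n, (N <= n)%N -> l2_dot (u n - l) (u n - l) < e.
Proof.
move=> uc.
have /choice[l ul] : forall i, exists l : H, (fun n => u n i) @ \oo --> l.
  move=> i; have [|l ul] := @hilbert_cauchy_seq R H (fun n => u n i).
    move=> e e0; have [|N uN] := uc (e ^+ 2); first by rewrite exprn_gt0.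
    exists N => m n Nm Nn; rewrite -(@ltr_pXn2r _ 2) ?nnegrE ?(ltW e0) //.
    by rewrite -l2_subE (le_lt_trans (l2_dot_coord _ _)) // uN.
  exists l; apply/cvgrPdist_lt => e /ul[N uN].
  by exists N => // n /= Nn; rewrite distrC uN.
have bnd e : 0 < e -> exists N, forall n, (N <= n)%N ->
    forall K, \sum_(k < K) `|u n k - l k| ^+ 2 <= e.
  move=> /uc[N uN]; exists N => n Nn K.
  pose s m : C := \sum_(k < K) `|u n k - u m k| ^+ 2.
  have sl : s @ \oo --> (\sum_(k < K) `|u n k - l k| ^+ 2 : C).
    apply: (@cvg_ord_sum R (fun m k => `|u n k - u m k| ^+ 2 : C)
      (fun k => `|u n k - l k| ^+ 2)) => k.
    rewrite expr2 (_ : (fun _ => _) =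
      (fun m => (`|u n k - u m k| : C) * (`|u n k - u m k| : C))) //.
    have h : (fun m => `|u n k - u m k| : C) @ \oo --> (`|u n k - l k| : C).
      by apply: cvg_norm; exact: (cvgB (cvg_cst _) (ul k)).
    exact: (cvgM h h).
  apply: (complex_lim_le (N := N) sl) => m Nm; rewrite ltW //.
  by apply: le_lt_trans (uN n m Nn Nm); exact: (l2_dot_ge (u n - u m) K).
have lP : l \in l2_pred.
  have [N uN] := bnd 1 ltr01.
  have -> : l = (u N : nat -> H) + (-1) *: ((u N : nat -> H) - l).
    by rewrite scaleN1r opprB addrC subrK.
  apply: rpredD; first exact: (valP (u N)).
  by apply: rpredZ; apply/l2_predP; exists 1 => K; exact: uN.
exists (L2 lP) => e e0; have [|N uN] := bnd (e / 2).
  by rewrite divr_gt0 // ltr0n.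
exists N => n Nn; apply: (@le_lt_trans _ _ (e / 2)).
  by apply: l2_dot_le => K; exact: uN.
by rewrite ltr_pdivrMr ?ltr0n // ltr_pMr // ltr1n.
Qed.

HB.instance Definition _ := Lmodule_isHilbert.Build R l2
  l2_dot_linearl l2_dotC l2_dot_ge0 l2_dot_eq0 l2_dot_complete.

End HilbertSequences.
Arguments l2_dot_cvg {R H} x y.

Section BoundedOperators.
Context (R : realType) (H : hilbertType R).
Implicit Types (x : H) (M : R[i]).

Definition bop_pred : {pred H -> H} := fun T =>
  `[< linear T /\ exists M, forall x, `|T x| <= M * `|x| >].

Lemma bop_submod_closed : submod_closed bop_pred.
Proof.
split=> [|a T S /asboolP[Tl [M TM]] /asboolP[Sl [N SN]]]; apply/asboolP.
  split; first by move=> a x y; rewrite scaler0 addr0.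
  by exists 0 => x; rewrite normr0 mul0r.
split=> [b x y|].
  have E z : (a *: T + S) z = a *: T z + S z by [].
  rewrite !E Tl Sl scalerDr !scalerDr !scalerA (mulrC b a).
  by rewrite addrACA.
exists (`|a| * M + N) => x.
have -> : (a *: T + S) x = a *: T x + S x by [].
rewrite (le_trans (ler_normD _ _)) // normrZ mulrDl -mulrA.
by apply: lerD; [apply: ler_wpM2l|].
Qed.

HB.instance Definition _ :=
  GRing.isSubmodClosed.Build R[i] (H -> H) bop_pred bop_submod_closed.

(* B(H), with the operator norm. *)
Record bop := Bop { bop_fun :> H -> H; _ : bop_fun \in bop_pred }.

HB.instance Definition _ := [isSub for bop_fun].
HB.instance Definition _ := [Choice of bop by <:].
HB.instance Definition _ := [SubChoice_isSubLmodule of bop by <:].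

Lemma bop_ext (S T : bop) : (forall x, S x = T x) -> S = T.
Proof. by move=> ST; apply: val_inj; apply/funext. Qed.

Lemma bop_linear (T : bop) : linear T.
Proof. by have /asboolP[] := valP T. Qed.

HB.instance Definition _ (T : bop) :=
  GRing.isLinear.Build R[i] H H *:%R T (@bop_linear T).

Lemma bop_bound (T : bop) : exists2 M, 0 <= M & forall x, `|T x| <= M * `|x|.
Proof.
have /asboolP[_ [M TM]] := valP T; exists `|M| => // x.
rewrite -[in leRHS](normr_id x) -normrM ger0_norm //.
exact: le_trans (normr_ge0 _) (TM x).
Qed.

Definition opnorm (T : bop) : R :=
  sup [set complex.Re `|T x| | x in [set x | `|x| <= 1]].

Lemma hilbert_normE x : `|x| = (complex.Re `|x|)%:C%C.
Proof. by rewrite RRe_real // normr_real. Qed.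

Lemma opnorm_has_sup (T : bop) :
  has_sup [set complex.Re `|T x| | x in [set x | `|x| <= 1]].
Proof.
split; first by exists (complex.Re `|T 0|); exists 0 => //=; rewrite normr0.
have [M M0 TM] := bop_bound T; exists (complex.Re M) => _ [x /= x1 <-].
have : `|T x| <= M by rewrite (le_trans (TM x)) // ler_piMr.
by rewrite lecE => /andP[].
Qed.

Lemma opnorm_ge0 (T : bop) : 0 <= opnorm T.
Proof.
apply: (ub_le_sup (proj2 (opnorm_has_sup T))).
by exists 0 => /=; rewrite ?normr0 // linear0 normr0.
Qed.

Lemma opnormP (T : bop) x : `|T x| <= (opnorm T)%:C%C * `|x|.
Proof.
have [->|x0] := eqVneq x 0; first by rewrite linear0 !normr0 mulr0.
have xp : 0 < `|x| by rewrite normr_gt0.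
rewrite -ler_pdivrMr // mulrC.
have -> : `|x|^-1 * `|T x| = `|T (`|x|^-1 *: x)|.
  by rewrite linearZ normrZ normfV normr_id.
rewrite hilbert_normE lecR; apply: (ub_le_sup (proj2 (opnorm_has_sup T))).
exists (`|x|^-1 *: x) => //=.
by rewrite normrZ normfV normr_id mulVf // gt_eqF.
Qed.

Lemma opnorm_le (T : bop) M : 0 <= M -> (forall x, `|T x| <= M * `|x|) ->
  (opnorm T)%:C%C <= M.
Proof.
move=> M0 TM.
have Mr : M = (complex.Re M)%:C%C by rewrite RRe_real // ger0_real.
rewrite Mr lecR; apply: ge_sup; first exact: (proj1 (opnorm_has_sup T)).
move=> _ [x /= x1 <-]; rewrite -lecR -hilbert_normE -Mr.
by rewrite (le_trans (TM x)) // ler_piMr.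
Qed.

Let bnorm (T : bop) : R[i] := (opnorm T)%:C%C.

Let bnorm_ge0 T : 0 <= bnorm T.
Proof. by rewrite ler0c opnorm_ge0. Qed.

Let bnormD (S T : bop) : bnorm (S + T) <= bnorm S + bnorm T.
Proof.
apply: opnorm_le => [|x]; first by rewrite addr_ge0.
have -> : (S + T) x = S x + T x by [].
rewrite (le_trans (ler_normD _ _)) // mulrDl.
by apply: lerD; exact: opnormP.
Qed.

Let bnormZ (a : R[i]) (T : bop) : bnorm (a *: T) = `|a| * bnorm T.
Proof.
have E (b : R[i]) (S : bop) x : (b *: S) x = b *: S x by [].
have le b (S : bop) : bnorm (b *: S) <= `|b| * bnorm S.
  apply: opnorm_le => [|x]; first by rewrite mulr_ge0.
  by rewrite E normrZ -mulrA ler_wpM2l // opnormP.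
apply/eqP; rewrite eq_le le /=.
have [->|a0] := eqVneq a 0; first by rewrite normr0 mul0r.
rewrite -ler_pdivlMl ?normr_gt0 // -normfV.
by apply: le_trans (le _ _); rewrite scalerA mulVf // scale1r.
Qed.

Let bnorm_eq0 (T : bop) : bnorm T = 0 -> T = 0.
Proof.
move=> T0; apply: bop_ext => x; apply/eqP; rewrite -normr_le0.
by rewrite (le_trans (opnormP T x)) // -/(bnorm T) T0 mul0r.
Qed.

HB.instance Definition _ :=
  Lmodule_isNormed.Build R[i] bop bnormD bnormZ bnorm_eq0.

Lemma bop_normE (T : bop) : `|T| = (opnorm T)%:C%C.
Proof. by []. Qed.

Lemma bop_normP (T : bop) x : `|T x| <= `|T| * `|x|.
Proof. exact: opnormP. Qed.

Lemma bop_norm_le (T : bop) M : 0 <= M -> (forall x, `|T x| <= M * `|x|) ->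
  `|T| <= M.
Proof. exact: opnorm_le. Qed.

Lemma bop_cauchy_seq (u : nat -> bop) :
  (forall e : R[i], 0 < e -> exists N, forall m n, (N <= m)%N -> (N <= n)%N ->
     `|u m - u n| < e) ->
  exists l : bop, forall e : R[i], 0 < e ->
    exists N, forall n, (N <= n)%N -> `|u n - l| < e.
Proof.
move=> uc; have uB m n x : (u m - u n) x = u m x - u n x by [].
have lim_le (v : nat -> H) w M N : v @ \oo --> w ->
    (forall n, (N <= n)%N -> `|v n| <= M) -> `|w| <= M.
  by move=> vw vM; exact: (complex_lim_le (cvg_norm vw) vM).
have /choice[l ul] : forall x : H, exists y : H, (fun n => u n x) @ \oo --> y.
  move=> x; have x1 : 0 < `|x| + 1 by rewrite ltr_wpDl.
  have [|y uy] := @hilbert_cauchy_seq R H (fun n => u n x).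
    move=> e e0; have [|N uN] := uc (e / (`|x| + 1)); first exact: divr_gt0.
    exists N => m n Nm Nn; rewrite -uB (le_lt_trans (bop_normP _ _)) //.
    apply: (@le_lt_trans _ _ (`|u m - u n| * (`|x| + 1))).
      by rewrite ler_wpM2l // lerDl.
    by rewrite -ltr_pdivlMr // uN.
  exists y; apply/cvgrPdist_lt => e /uy[N uN].
  by exists N => // n /= Nn; rewrite distrC uN.
have bnd e : 0 < e -> exists N, forall n, (N <= n)%N ->
    forall x, `|u n x - l x| <= e * `|x|.
  move=> /uc[N uN]; exists N => n Nn x.
  apply: (@lim_le (fun m => u n x - u m x) _ _ N).
    exact: (cvgB (cvg_cst _) (ul x)).
  move=> m Nm; rewrite -uB (le_trans (bop_normP _ _)) // ler_wpM2r //.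
  by rewrite ltW // uN.
have lP : l \in bop_pred.
  apply/asboolP; split=> [a x y|].
    have h : (fun n => u n (a *: x + y)) @ \oo --> a *: l x + l y.
      rewrite (_ : (fun _ => _) = (fun n => a *: u n x + u n y)); last first.
        by apply/funext => n; rewrite linearP.
      exact: (cvgD (cvgZl_tmp (ul x)) (ul y)).
    by apply: (cvg_unique _ (ul (a *: x + y)) h); exact: norm_hausdorff.
  have [N uN] := bnd 1 ltr01; exists (`|u N| + 1) => x.
  rewrite -[l x](subKr (u N x)) (le_trans (ler_normB _ _)) // mulrDl.
  by apply: lerD; [exact: bop_normP|exact: uN].
exists (Bop lP) => e e0.
have e2 : 0 < e / 2 by rewrite divr_gt0 // ltr0n.
have [N uN] := bnd _ e2; exists N => n Nn; apply: (@le_lt_trans _ _ (e / 2)).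
  by apply: bop_norm_le; [exact: ltW|move=> x; exact: uN].
by rewrite ltr_pdivrMr ?ltr0n // ltr_pMr // ltr1n.
Qed.

HB.instance Definition _ :=
  Uniform_isComplete.Build bop (seq_complete bop_cauchy_seq).

Lemma bop_id_subproof : idfun \in bop_pred.
Proof.
by apply/asboolP; split=> //; exists 1 => x; rewrite mul1r.
Qed.

Definition bop_id : bop := Bop bop_id_subproof.

Lemma bop_comp_subproof (S T : bop) : (S \o T) \in bop_pred.
Proof.
apply/asboolP; split=> [a x y|]; first by rewrite /= !linearP.
exists (`|S| * `|T|) => x /=; rewrite (le_trans (bop_normP _ _)) // -mulrA.
by rewrite ler_wpM2l // bop_normP.
Qed.

Definition bop_comp (S T : bop) : bop := Bop (bop_comp_subproof S T).

Definition is_adjoint (T S : bop) : Prop :=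
  forall x y, hdot (T x) y = hdot x (S y).

Definition psd (T : bop) : Prop := forall x, 0 <= hdot (T x) x.

End BoundedOperators.

Section MatrixOperators.
Context (R : realType) (H : hilbertType R) (d : nat).

Lemma hpow_norm_coord (x : hpow H d) i : `|x i| <= `|x|.
Proof.
rewrite -(@ler_pXn2r _ 2) ?nnegrE // -!hdot_norm [leRHS](bigD1 i) //=.
by rewrite lerDl; apply: sumr_ge0 => j _; exact: hdot_ge0.
Qed.

Lemma hpow_norm_sum (x : hpow H d) : `|x| <= \sum_i `|x i|.
Proof.
have s0 : 0 <= \sum_i `|x i| by apply: sumr_ge0.
rewrite -(@ler_pXn2r _ 2) ?nnegrE // -hdot_norm expr2 mulr_suml.
apply: ler_sum => i _; rewrite hdot_norm expr2 ler_wpM2l //.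
by rewrite (bigD1 i) //= lerDl sumr_ge0.
Qed.

(* The identification of M_d(B(H)) with B(H^d): norm and positivity of a matrix
   a are those of the operator mx_op a. *)
Definition mx_fun (a : 'M[bop H]_d) (x : hpow H d) : hpow H d :=
  [ffun i => \sum_j a i j (x j)].

Lemma mx_op_subproof a : mx_fun a \in @bop_pred R (hpow H d).
Proof.
apply/asboolP; split=> [c x y|].
  apply/ffunP => i; rewrite !ffunE scaler_sumr -big_split /=.
  by apply: eq_bigr => j _; rewrite !ffunE linearP.
exists (\sum_i \sum_j `|a i j|) => x.
rewrite (le_trans (hpow_norm_sum _)) // mulr_suml; apply: ler_sum => i _.
rewrite ffunE (le_trans (ler_norm_sum _ _ _)) // mulr_suml.
apply: ler_sum => j _; rewrite (le_trans (bop_normP _ _)) // ler_wpM2l //.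
exact: hpow_norm_coord.
Qed.

Definition mx_op (a : 'M[bop H]_d) : bop (hpow H d) := Bop (mx_op_subproof a).

End MatrixOperators.

Section OperatorSystems.
Context (R : realType).
Implicit Types H K : hilbertType R.

(* The adjoint of a bounded operator is unique, so opsys_adj says that the
   adjoint of every element of E lies in E. No unit is required. *)
Record operator_system H (E : set (bop H)) : Prop := OperatorSystem {
  opsys_closed : closed E;
  opsys0 : E 0;
  opsys_lin : forall (a : R[i]) x y, E x -> E y -> E (a *: x + y);
  opsys_adj : forall x, E x -> exists2 y, E y & is_adjoint x y
}.

(* C*-algebras are concrete: norm-closed self-adjoint subalgebras of B(H). The
   operator system structure of a C*-algebra is that of any such faithful
   representation. *)
Definition cstar_algebra H (A : set (bop H)) : Prop :=
  operator_system A /\ forall x y, A x -> A y -> A (bop_comp x y).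

(* Maps out of a subspace E of B(H) are functions on B(H) of which only the
   values on E matter. *)
Definition linear_on H K (E : set (bop H)) (phi : bop H -> bop K) : Prop :=
  forall (a : R[i]) x y, E x -> E y -> phi (a *: x + y) = a *: phi x + phi y.

Definition mx_in H (E : set (bop H)) d (a : 'M[bop H]_d) : Prop :=
  forall i j, E (a i j).

Definition completely_positive H K (E : set (bop H)) (phi : bop H -> bop K) :=
  forall d (a : 'M[bop H]_d), mx_in E a ->
    psd (mx_op a) -> psd (mx_op (map_mx phi a)).

Definition completely_contractive H K (E : set (bop H)) (phi : bop H -> bop K) :=
  forall d (a : 'M[bop H]_d), mx_in E a ->
    `|mx_op (map_mx phi a)| <= `|mx_op a|.

Definition completely_isometric H K (E : set (bop H)) (phi : bop H -> bop K) :=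
  forall d (a : 'M[bop H]_d), mx_in E a ->
    `|mx_op (map_mx phi a)| = `|mx_op a|.

Definition opsys_iso H K (E : set (bop H)) (F : set (bop K)) : Prop :=
  exists (phi : bop H -> bop K) (psi : bop K -> bop H),
    [/\ linear_on E phi,
        (forall x, E x -> F (phi x) /\ psi (phi x) = x),
        (forall y, F y -> E (psi y) /\ phi (psi y) = y),
        completely_isometric E phi
      & completely_positive E phi /\ completely_positive F psi].

Definition iso_to_cstar_algebra H (E : set (bop H)) : Prop :=
  exists (K : hilbertType R) (A : set (bop K)), cstar_algebra A /\ opsys_iso E A.

(* Completely positive, completely contractive linear maps from E to F. *)
Definition cpcc_map H K (E : set (bop H)) (F : set (bop K))
    (phi : bop H -> bop K) : Prop :=
  [/\ linear_on E phi, (forall x, E x -> F (phi x)),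
      completely_positive E phi & completely_contractive E phi].

(* The matrix algebra M_n, as the algebra of all operators on C^n. *)
Definition Mn n : set (bop (hpow (cline R) n)) := setT.

Definition directed (I : Type) (le : I -> I -> Prop) : Prop :=
  [/\ exists i : I, True, (forall i, le i i),
      (forall i j k, le i j -> le j k -> le i k)
    & (forall i j, exists2 k, le i k & le j k)].

(* The filter of tails of a net indexed by I. *)
Definition net_filter (I : Type) (le : I -> I -> Prop) : set_system I :=
  [set P | exists i0, forall i, le i0 i -> P i].

Definition CPAP H (E : set (bop H)) : Prop :=
  exists (I : Type) (le : I -> I -> Prop) (n : I -> nat)
    (psi : forall i, bop H -> bop (hpow (cline R) (n i)))
    (phi : forall i, bop (hpow (cline R) (n i)) -> bop H),
  [/\ directed le, (forall i, (1 <= n i)%N),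
      (forall i, cpcc_map E (@Mn (n i)) (psi i)),
      (forall i, cpcc_map (@Mn (n i)) E (phi i))
    & forall x, E x -> phi i (psi i x) @[i --> net_filter le] --> x].

End OperatorSystems.

Definition lin_span (K : pzRingType) (V : lmodType K) (S : set V) : set V :=
  [set v | exists n (a : 'I_n -> K) (s : 'I_n -> V),
     (forall i, S (s i)) /\ v = \sum_i a i *: s i].

Lemma closure_normP (K : numFieldType) (V : normedModType K) (S : set V) x :
  closure S x <-> forall e : K, 0 < e -> exists2 y, S y & `|x - y| < e.
Proof.
split=> [Sx e e0|Sx B /nbhs_ballP[e /= e0 eB]].
  have [y [Sy]] := Sx (ball x e) (nbhsx_ballx x e e0).
  by rewrite -ball_normE => xy; exists y.
have [y Sy xy] := Sx e e0; exists y; split=> //.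
by apply: eB; rewrite -ball_normE.
Qed.

Section HilbertTensor.
Context (R : realType) (H : hilbertType R).
Local Notation C := (R[i]^o).

Record c0 := C0 {
  c0_fun :> nat -> C;
  c0_lim : c0_fun @ \oo --> (0 : C)
}.

Lemma c0_bounded (f : c0) : exists2 M : R[i], 0 <= M & forall n, `|f n| <= M.
Proof.
have /cvgrPdist_lt/(_ 1 ltr01)[N _ fN] := @c0_lim f.
have s0 : 0 <= \sum_(k < N) `|f k| by apply: sumr_ge0.
exists (1 + \sum_(k < N) `|f k|) => [|n]; first by rewrite addr_ge0.
case: (leqP N n) => [Nn|nN].
  have := fN n Nn; rewrite /= sub0r normrN => /ltW f1.
  by rewrite (le_trans f1) // lerDl.
rewrite (bigD1 (Ordinal nN)) //= addrCA lerDl addr_ge0 //.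
exact: sumr_ge0.
Qed.

(* The operator T (x) f for f in c_0(N) acting diagonally on l^2(N): through
   the identification of l2 with the tensor product it multiplies the n-th
   coordinate by f n and applies T to it (see tens_op_etens). *)
Definition tens_fun (K : hilbertType R) (T : bop K) (f : c0) (x : nat -> K) :
  nat -> K := fun n => f n *: T (x n).

Lemma tens_fun_bound (K : hilbertType R) (T : bop K) (f : c0) : exists2 M : R[i],
  0 <= M & forall (x : nat -> K) n,
    \sum_(k < n) `|tens_fun T f x k| ^+ 2 <= M ^+ 2 * \sum_(k < n) `|x k| ^+ 2.
Proof.
have [M M0 fM] := c0_bounded f; exists (M * `|T|); first by rewrite mulr_ge0.
move=> x n; rewrite mulr_sumr; apply: ler_sum => k _.
rewrite -exprMn ler_pXn2r ?nnegrE ?mulr_ge0 // normrZ -mulrA.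
by apply: ler_pM => //; exact: bop_normP.
Qed.

Lemma tens_fun_l2 (K : hilbertType R) (T : bop K) (f : c0) (x : l2 K) :
  tens_fun T f x \in @l2_pred R K.
Proof.
have [M M0 TM] := tens_fun_bound T f; have [B xB] := l2P x.
apply/l2_predP; exists (M ^+ 2 * B) => n; rewrite (le_trans (TM x n)) //.
by rewrite ler_wpM2l // exprn_ge0.
Qed.

Lemma tens_op_subproof (K : hilbertType R) (T : bop K) (f : c0) :
  (fun x : l2 K => L2 (tens_fun_l2 T f x)) \in @bop_pred R (l2 K).
Proof.
apply/asboolP; split=> [a x y|].
  apply: l2_ext => n.
  have E (z : l2 K) : L2 (tens_fun_l2 T f z) n = f n *: T (z n) by [].
  rewrite E.
  have -> : (a *: x + y) n = a *: x n + y n by [].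
  by rewrite linearP scalerDr scalerA mulrC -scalerA.
have [M M0 TM] := tens_fun_bound T f; exists M => x.
rewrite -(@ler_pXn2r _ 2) ?nnegrE ?mulr_ge0 // exprMn -!hdot_norm.
apply: l2_dot_le => n; rewrite (le_trans (TM x n)) //.
by rewrite ler_wpM2l ?exprn_ge0 //; exact: l2_dot_ge.
Qed.

Definition tens_op (K : hilbertType R) (T : bop K) (f : c0) : bop (l2 K) :=
  Bop (tens_op_subproof T f).

Definition diag_op (f : c0) : bop (l2 (cline R)) := tens_op (bop_id (cline R)) f.

Lemma diag_opE (f : c0) (y : l2 (cline R)) n : diag_op f y n = f n * y n.
Proof. by []. Qed.

Lemma l2_delta_subproof m :
  (fun n => (n == m)%:R : cline R) \in @l2_pred R (cline R).
Proof.
apply/l2_predP; exists 1 => n.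
rewrite (@le_trans _ _ (\sum_(k < n) (k == m :> nat)%:R)) //.
  by apply: ler_sum => k _; rewrite normr_nat -natrX ler_nat; case: eqP.
case: (ltnP m n) => mn.
  rewrite (bigD1 (Ordinal mn)) //= eqxx big1 ?addr0 // => k /eqP km.
  by case: eqP => // e; case: km; exact: val_inj.
rewrite big1 // => k _; case: eqP => // km.
by move: (ltn_ord k); rewrite km ltnNge mn.
Qed.

Definition l2_delta m : l2 (cline R) := L2 (l2_delta_subproof m).

Lemma etens_subproof (x : H) (y : l2 (cline R)) :
  (fun n => (y n : R[i]) *: x) \in @l2_pred R H.
Proof.
have [M yM] := l2P y; apply/l2_predP; exists (M * `|x| ^+ 2) => n.
under eq_bigr do rewrite normrZ exprMn.
by rewrite -mulr_suml ler_wpM2r // exprn_ge0.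
Qed.

(* Elementary tensors. *)
Definition etens (x : H) (y : l2 (cline R)) : l2 H := L2 (etens_subproof x y).

Lemma hdot_etens x x' y y' :
  hdot (etens x y) (etens x' y') = hdot x x' * hdot y y'.
Proof.
apply: l2_dotP.
rewrite (_ : series _ = (fun n => hdot x x' *:
   (series (fun k => hdot (y k) (y' k) : C) n))).
  exact: (cvgZl_tmp (@l2_dot_cvg R (cline R) y y')).
apply/funext => n; rewrite !seriesEord /= scaler_sumr.
by apply: eq_bigr => k _; rewrite hdotZl hdotZr [RHS]mulrC mulrA.
Qed.

Lemma etens_total :
  closure (lin_span [set etens x y | x in [set: H] & y in [set: l2 (cline R)]])
  = [set: l2 H].
Proof.
apply/seteqP; split=> // x _; apply/closure_normP => e e0.
have [n xn] : exists n, `|x| ^+ 2 - \sum_(k < n) `|x k| ^+ 2 < e ^+ 2.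
  have /cvgrPdist_lt/(_ (e ^+ 2) (exprn_gt0 _ e0))[n _ nN] := l2_dot_cvg x x.
  exists n; have := nN n (leqnn n); rewrite /= l2_dot_partial -hdot_norm.
  by rewrite ger0_norm // subr_ge0; exact: l2_dot_ge.
pose t := \sum_(k < n) etens (x k) (l2_delta k).
have tE j : t j = if (j < n)%N then x j else 0.
  rewrite /t; elim: n {xn t} => [|n IH]; first by rewrite big_ord0.
  rewrite big_ord_recr.
  set s := (\sum_(i < n) _ : l2 H) in IH *.
  have -> : (s + etens (x n) (l2_delta n)) j
    = s j + (l2_delta n j : R[i]) *: x n by [].
  rewrite IH /l2_delta /= ltnS [(j <= n)%N]leq_eqVlt.
  by case: (ltngtP j n) => [jn|jn|->] /=; rewrite ?scale0r ?scale1r ?addr0 ?add0r.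
exists t.
  exists n, (fun=> 1), (fun k : 'I_n => etens (x k) (l2_delta k)); split.
    by move=> i; exists (x i) => //; exists (l2_delta i).
  by apply: eq_bigr => i _; rewrite scale1r.
rewrite -(@ltr_pXn2r _ 2) ?nnegrE ?(ltW e0) //; apply: le_lt_trans xn.
rewrite -!hdot_norm; apply: l2_dot_le => m; rewrite lerBrDr.
suff: \sum_(k < m) `|x k - t k| ^+ 2 + \sum_(k < n) `|x k| ^+ 2 <= l2_dot x x.
  by [].
apply: le_trans (l2_dot_ge x (maxn m n)).
have widen p q (f : nat -> R[i]) : (p <= q)%N ->
    \sum_(k < p) f k = \sum_(k < q) (if (k < p)%N then f k else 0).
  by move=> pq; rewrite (big_ord_widen q f pq) big_mkcond.
rewrite (widen m _ (fun k => `|x k - t k| ^+ 2) (leq_maxl m n)).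
rewrite (widen n _ (fun k => `|x k| ^+ 2) (leq_maxr m n)).
rewrite -big_split /=; apply: ler_sum => k _.
rewrite tE; case: (ltnP k n) => _; last first.
  by rewrite subr0 addr0; case: ifP => _ //; exact: exprn_ge0.
by rewrite subrr normr0 expr0n /= if_same add0r.
Qed.

Lemma tens_op_etens (T : bop H) (f : c0) x y :
  tens_op T f (etens x y) = etens (T x) (diag_op f y).
Proof. by apply: l2_ext => n; rewrite /= /tens_fun /= linearZ scalerA. Qed.

(* The norm-closed linear span of the operators T (x) f, T in E, f in c_0(N). *)
Definition tensor_c0 (E : set (bop H)) : set (bop (l2 H)) :=
  closure (lin_span [set tens_op T f | T in E & f in [set: c0]]).

End HilbertTensor.

Section TensorOperatorSystem.
Context (R : realType) (H : hilbertType R).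
Local Notation C := (R[i]^o).

Lemma adjoint_norm (K : hilbertType R) (T S : bop K) :
  is_adjoint T S -> `|S| <= `|T|.
Proof.
move=> TS; apply: bop_norm_le => // y.
have [->|Sy] := eqVneq (S y) 0; first by rewrite normr0 mulr_ge0.
rewrite -(@ler_pM2r _ `|S y|) ?normr_gt0 // -expr2 -hdot_norm -TS.
rewrite -[leLHS]ger0_norm ?TS ?hdot_ge0 // -TS.
rewrite (le_trans (hdot_CauchySchwarz _ _)) // mulrAC ler_wpM2r //.
exact: bop_normP.
Qed.

Lemma adjoint_lin (K : hilbertType R) (a : R[i]) (T S T' S' : bop K) :
  is_adjoint T S -> is_adjoint T' S' ->
  is_adjoint (a *: T + T') (a^* *: S + S').
Proof.
move=> TS TS' x y.
have E (b : R[i]) (U V : bop K) z : (b *: U + V) z = b *: U z + V z by [].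
by rewrite !E hdotDl hdotZl TS TS' hdotDr hdotZr conjCK.
Qed.

Lemma c0_conj_subproof (f : c0 R) : (fun n => (f n)^* : C) @ \oo --> (0 : C).
Proof. by have := @cvg_conjc R f 0 (@c0_lim R f); rewrite conjC0. Qed.

Definition c0_conj (f : c0 R) : c0 R := C0 (c0_conj_subproof f).

Lemma tens_op_adjoint (T S : bop H) (f : c0 R) :
  is_adjoint T S -> is_adjoint (tens_op T f) (tens_op S (c0_conj f)).
Proof.
move=> TS x y; apply: l2_dotP.
rewrite (_ : (fun _ => _) = (fun n => hdot (x n) (tens_op S (c0_conj f) y n))).
  exact: l2_dot_cvg.
by apply/funext => n /=; rewrite /tens_fun hdotZl TS hdotZr conjCK.
Qed.

Lemma lin_span_lin (S : set (bop (l2 H))) a x y :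
  lin_span S x -> lin_span S y -> lin_span S (a *: x + y).
Proof.
move=> [m [b [s [sS ->]]]] [n [c [t [tS ->]]]].
exists (m + n)%N,
  (fun i : 'I_(m + n) =>
     match fintype.split i with inl j => a * b j | inr j => c j end),
  (fun i : 'I_(m + n) =>
     match fintype.split i with inl j => s j | inr j => t j end); split.
  by move=> i; case: (fintype.split i).
rewrite big_split_ord scaler_sumr; congr (_ + _); apply: eq_bigr => i _.
  by rewrite (unsplitK (inl i)) scalerA.
by rewrite (unsplitK (inr i)).
Qed.

Lemma lin_span_adj (S : set (bop (l2 H))) :
  (forall x, S x -> exists2 y, S y & is_adjoint x y) ->
  forall x, lin_span S x -> exists2 y, lin_span S y & is_adjoint x y.
Proof.
move=> Sadj x [n [b [s [sS ->]]]].
have /choice[t tP] : forall i, exists y, S y /\ is_adjoint (s i) y.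
  by move=> i; have [y] := Sadj _ (sS i); exists y.
exists (\sum_i (b i)^* *: t i).
  by exists n, (fun i => (b i)^*), t; split=> // i; case: (tP i).
elim/big_ind2 : _ => [u v|T T' S' S''|i _].
- by rewrite hdot0l hdot0r.
- by move=> a1 a2; have := adjoint_lin 1 a1 a2; rewrite conjC1 !scale1r.
have := @adjoint_lin _ (b i) (s i) (t i) 0 0 (proj2 (tP i)).
by rewrite !addr0; apply=> u v; rewrite hdot0l hdot0r.
Qed.

Lemma closure_lin (S : set (bop (l2 H))) :
  (forall a x y, S x -> S y -> S (a *: x + y)) ->
  forall (a : R[i]) x y, closure S x -> closure S y -> closure S (a *: x + y).
Proof.
move=> Slin a x y /closure_normP Sx /closure_normP Sy.
apply/closure_normP => e e0.
have a1 : 0 < `|a| + 1 by rewrite ltr_wpDl.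
have e2 : 0 < e / 2 by rewrite divr_gt0 // ltr0n.
have [x' Sx' xx'] := Sx _ (divr_gt0 e2 a1).
have [y' Sy' yy'] := Sy _ e2.
exists (a *: x' + y'); first exact: Slin.
rewrite opprD addrACA -scalerBr (le_lt_trans (ler_normD _ _)) // (splitr e).
apply: ler_ltD => //; rewrite normrZ.
apply: (@le_trans _ _ ((`|a| + 1) * `|x - x'|)).
  by rewrite ler_wpM2r // lerDl.
by rewrite -ler_pdivlMl // mulrC ltW.
Qed.

Lemma closure_adj (S : set (bop (l2 H))) :
  (forall a x y, S x -> S y -> S (a *: x + y)) ->
  (forall x, S x -> exists2 y, S y & is_adjoint x y) ->
  forall x, closure S x -> exists2 y, closure S y & is_adjoint x y.
Proof.
move=> Slin Sadj T /closure_normP ST.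
have /choice[u uP] : forall n : nat, exists y, S y /\ `|T - y| < n.+1%:R^-1.
  by move=> n; have [|y] := ST (n.+1%:R^-1); [rewrite invr_gt0 ltr0n|exists y].
have /choice[v vP] : forall n, exists y, S y /\ is_adjoint (u n) y.
  by move=> n; have [y] := Sadj _ (proj1 (uP n)); exists y.
have uT e : 0 < e -> exists N, forall n, (N <= n)%N -> `|T - u n| < e.
  move=> /complex_invS_lt[N Ne]; exists N => n Nn.
  exact: lt_trans (proj2 (uP n)) (Ne n Nn).
have [|l vl] := bop_cauchy_seq (u := v).
  move=> e e0; have [|N uN] := uT (e / 2); first by rewrite divr_gt0 // ltr0n.
  exists N => m n Nm Nn.
  have /adjoint_norm le : is_adjoint (u m - u n) (v m - v n).
    have := adjoint_lin (-1) (proj2 (vP n)) (proj2 (vP m)).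
    by rewrite rmorphN /= conjC1 !scaleN1r ![- _ + _]addrC.
  rewrite (le_lt_trans le) // -(subrKA T) (le_lt_trans (ler_normD _ _)) //.
  rewrite (splitr e); apply: ltrD; last exact: uN.
  by rewrite distrC; exact: uN.
exists l.
  apply/closure_normP => e /vl[N vN]; exists (v N); first exact: (proj1 (vP N)).
  by rewrite distrC; exact: vN.
move=> x y; apply/eqP; rewrite -subr_eq0 -normr_le0; apply/ler_addgt0Pl => e e0.
rewrite addr0.
pose c := `|x| * `|y| + 1.
have c0 : 0 < c by rewrite ltr_wpDl // mulr_ge0.
have e2 : 0 < e / 2 / c by rewrite !divr_gt0 // ltr0n.
have [N1 uN] := uT _ e2; have [N2 vN] := vl _ e2; pose n := maxn N1 N2.
have E (U V : bop (l2 H)) z : (U - V) z = U z - V z by [].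
have -> : hdot (T x) y - hdot x (l y)
    = hdot ((T - u n) x) y + hdot x ((v n - l) y).
  by rewrite !E hdotBl hdotBr (proj2 (vP n)) addrA subrK.
have le1 : `|hdot ((T - u n) x) y| <= `|T - u n| * (`|x| * `|y|).
  by rewrite (le_trans (hdot_CauchySchwarz _ _)) // mulrA ler_wpM2r // bop_normP.
have le2 : `|hdot x ((v n - l) y)| <= `|v n - l| * (`|x| * `|y|).
  by rewrite (le_trans (hdot_CauchySchwarz _ _)) // mulrCA ler_wpM2l // bop_normP.
rewrite (le_trans (ler_normD _ _)) // (splitr e).
have fin r : r < e / 2 / c -> 0 <= r -> r * (`|x| * `|y|) <= e / 2.
  move=> re r0; apply: (@le_trans _ _ (r * c)).
    by rewrite ler_wpM2l // /c lerDl.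
  by rewrite -ler_pdivlMr // ltW.
apply: lerD.
  by apply: le_trans le1 (fin _ (uN _ (leq_maxl _ _)) (normr_ge0 _)).
by apply: le_trans le2 (fin _ (vN _ (leq_maxr _ _)) (normr_ge0 _)).
Qed.

Lemma tensor_c0_operator_system (E : set (bop H)) :
  operator_system E -> operator_system (tensor_c0 E).
Proof.
move=> [_ _ _ Eadj].
have adj : forall x, lin_span [set tens_op T f | T in E & f in [set: c0 R]] x ->
    exists2 y, lin_span [set tens_op T f | T in E & f in [set: c0 R]] y
      & is_adjoint x y.
  apply: lin_span_adj => _ [T ET [f _ <-]]; have [S ES TS] := Eadj T ET.
  exists (tens_op S (c0_conj f)); last exact: tens_op_adjoint.
  by exists S => //; exists (c0_conj f).
have lin := @lin_span_lin [set tens_op T f | T in E & f in [set: c0 R]].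
split.
- exact: closed_closure.
- apply: subset_closure; exists 0%N, (fun=> 0), (fun=> 0).
  by split=> [[]|]; rewrite ?big_ord0.
- exact: closure_lin.
- exact: closure_adj.
Qed.

End TensorOperatorSystem.

(* Main.v *)
(* CPAP: the N-th truncation of tensor_c0 E factors through M_((N+1)n) by
   applying an approximate factorization of E through M_n to each of the first
   N+1 diagonal blocks; it converges since the blocks of an element of
   tensor_c0 E tend to 0 and all maps are contractive.

   Not a C*-algebra: let phi be an isomorphism of tensor_c0 E onto a C*-algebra A,
   and let e be the projection onto the 0-th block, which lies in tensor_c0 E as
   E is unital. Among positive contractions dominated by a multiple of e, e is
   the largest; transporting this to A with u = phi e and the element 2u - u^2
   gives u = u^2. Being in the corner cut down by a projection is an order
   property (domination by a multiple of the projection), so phi restricts to an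
   isomorphism from e (tensor_c0 E) e, a copy of E, onto the C*-algebra u A u. *)
From HB Require Import structures.
Require Import Defs.
From mathcomp Require Import all_boot all_order all_algebra.
From mathcomp Require Import boolp classical_sets functions reals topology.
From mathcomp Require Import normedtype sequences complex.
From mathcomp Require Import ring lra.

Set Implicit Arguments.
Unset Strict Implicit.
Unset Printing Implicit Defensive.

Import Order.TTheory GRing.Theory Num.Theory.
Import numFieldNormedType.Exports.

Local Open Scope classical_set_scope.
Local Open Scope ring_scope.

(** * Positive operators, isometries and amplifications *)

(** The adjoint is part of the data, so that conjugation by the isometry is given by explicit
    formulas. [iso_adj] and [isoK] say v^* v = 1; preservation of the norm follows. *)
Record hisometry (R : realType) (K L : hilbertType R) := HIsometry {
  iso_fun :> {linear K -> L};
  coiso : {linear L -> K};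
  iso_adj : forall x y, hdot (iso_fun x) y = hdot x (coiso y);
  isoK : cancel iso_fun coiso
}.

Section Positivity.
Context (R : realType) (K : hilbertType R).
Implicit Types (T S u : bop K) (x y : K).

Lemma bopDE S T x : (S + T) x = S x + T x. Proof. by []. Qed.
Lemma bopBE S T x : (S - T) x = S x - T x. Proof. by []. Qed.
Lemma bopZE (a : R[i]) T x : (a *: T) x = a *: T x. Proof. by []. Qed.

Lemma bop_sumE I (r : seq I) (P : pred I) (F : I -> bop K) x :
  (\sum_(i <- r | P i) F i) x = \sum_(i <- r | P i) F i x.
Proof. by apply: (big_morph (fun T : bop K => T x)). Qed.

Lemma psdD S T : psd S -> psd T -> psd (S + T).
Proof. by move=> Sp Tp x; rewrite bopDE hdotDl addr_ge0. Qed.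

(** Polarization: the form of T is real at x + a y for a = 1 and for a = i, and together these make
    the cross terms conjugate to each other. *)
Lemma psd_adjoint T : psd T -> is_adjoint T T.
Proof.
move=> Tp x y.
have P (a : R[i]) : 0 <= a * hdot (T y) x + a^* * hdot (T x) y
    + (hdot (T x) x + `|a| ^+ 2 * hdot (T y) y).
  have := Tp (x + a *: y).
  rewrite linearD linearZ /= !hdotDl !hdotDr !hdotZl !hdotZr normCK.
  by move/le_trans; apply; rewrite le_eqVlt; apply/orP; left; apply/eqP; ring.
have real (a : R[i]) : a * hdot (T y) x + a^* * hdot (T x) y \is Num.real.
  rewrite -[X in X \is _](addrK (hdot (T x) x + `|a| ^+ 2 * hdot (T y) y)).
  apply: rpredB; apply: ger0_real; first exact: P.
  by rewrite addr_ge0 ?mulr_ge0 ?exprn_ge0.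
rewrite [hdot x _]hdotC.
move: (real 1) (real 'i%C); rewrite rmorph1 !mul1r !CrealE.
case: (hdot (T x) y) => a b; case: (hdot (T y) x) => c e.
rewrite !eq_complex /= => /andP[_ /eqP h1] /andP[/eqP h2 /eqP h3].
by apply/eqP; rewrite eq_complex /=; apply/andP; split; apply/eqP; lra.
Qed.


(** T - T^2 = (1 - T) T (1 - T) + T (1 - T) T, a sum of two positive operators. *)
Lemma psd_contraction T : psd T -> psd (bop_id K - T) ->
  forall x, `|T x| ^+ 2 <= hdot (T x) x.
Proof.
move=> Tp Tc x; have := addr_ge0 (Tp (x - T x)) (Tc (T x)).
rewrite bopBE !linearB /= !hdotBl !hdotBr (psd_adjoint Tp (T x) x) -hdot_norm.
by rewrite -[in X in _ -> X]subr_ge0; congr (0 <= _); ring.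
Qed.

Lemma bop_norm_psd T : `|T| <= 1 -> psd T -> psd (bop_id K - T).
Proof.
move=> T1 Tp x; rewrite bopBE hdotBl subr_ge0 -[leLHS]ger0_norm //.
rewrite (le_trans (hdot_CauchySchwarz _ _)) // hdot_norm expr2 ler_wpM2r //.
by rewrite (le_trans (bop_normP _ _)) // ler_piMl.
Qed.

Lemma psd_norm_le1 T : psd T -> psd (bop_id K - T) -> `|T| <= 1.
Proof.
move=> Tp Tc; apply: bop_norm_le => // x.
rewrite mul1r -(@ler_pXn2r _ 2) ?nnegrE // (le_trans (psd_contraction Tp Tc x)) //.
by have := Tc x; rewrite bopBE hdotBl subr_ge0 hdot_norm.
Qed.

Lemma psdZ (c : R[i]) T : 0 <= c -> psd T -> psd (c *: T).
Proof. by move=> c0 Tp x; rewrite bopZE hdotZl mulr_ge0. Qed.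

(** After scaling to norm at most 1, [psd_contraction] bounds the norm of T x by the form of T at
    x. *)
Lemma psd_ker T x : psd T -> hdot (T x) x = 0 -> T x = 0.
Proof.
move=> Tp Tx; have c0 : 0 < `|T| + 1 by rewrite ltr_wpDl.
set c := _ + 1 in c0.
have Sp : psd (c^-1 *: T) by apply: psdZ => //; rewrite invr_ge0 ltW.
have S1 : `|c^-1 *: T| <= 1.
  by rewrite normrZ ger0_norm ?invr_ge0 ?(ltW c0) // ler_pdivrMl // mulr1 lerDl.
have := psd_contraction Sp (bop_norm_psd S1 Sp) x.
rewrite bopZE hdotZl Tx mulr0 => le0.
have /eqP : `|c^-1 *: T x| ^+ 2 == 0 by rewrite eq_le le0 exprn_ge0.
move/eqP; rewrite sqrf_eq0 normr_eq0 scaler_eq0 invr_eq0 gt_eqF //=.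
by move/eqP.
Qed.

(** At a kernel vector of u the form of T is both nonnegative and nonpositive, so the form of u + T
    vanishes there and [psd_ker] applies. *)
Lemma dominated_ker u T x : psd (u + T) -> psd (u - T) -> u x = 0 -> T x = 0.
Proof.
move=> p1 p2 ux; have : (u + T) x = 0.
  apply: psd_ker => //; apply/eqP; rewrite eq_le p1 andbT.
  by have := p2 x; rewrite bopBE bopDE ux sub0r add0r hdotNl oppr_ge0.
by rewrite bopDE ux add0r.
Qed.

Lemma psd_opp T : psd T -> psd (- T) -> T = 0.
Proof.
move=> p1 p2; apply: bop_ext => x; apply: (@dominated_ker 0) => //.
  by rewrite add0r.
by rewrite sub0r.
Qed.

End Positivity.

(** * Inflation v t v^* and compression v^* T v along an isometry v *)

Section Isometries.
Context (R : realType) (K L : hilbertType R) (v : hisometry K L).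
Implicit Types (x : K) (y : L) (t : bop K) (T : bop L).

Lemma iso_norm x : `|v x| = `|x|.
Proof.
apply/eqP; rewrite -(@eqrXn2 _ 2) // -!hdot_norm iso_adj isoK.
exact: eqxx.
Qed.

Lemma coiso_adj y x : hdot (coiso v y) x = hdot y (v x).
Proof. by rewrite hdotC -iso_adj -hdotC. Qed.

Lemma coiso_norm y : `|coiso v y| <= `|y|.
Proof.
have [->|y0] := eqVneq (coiso v y) 0; first by rewrite normr0.
rewrite -(@ler_pM2r _ `|coiso v y|) ?normr_gt0 // -expr2 -hdot_norm coiso_adj.
rewrite -[X in X <= _]ger0_norm; last by rewrite -coiso_adj hdot_ge0.
by rewrite (le_trans (hdot_CauchySchwarz _ _)) // iso_norm.
Qed.

Lemma inflate_subproof t : (fun y => v (t (coiso v y))) \in @bop_pred R L.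
Proof.
apply/asboolP; split=> [a x y|]; first by rewrite !linearP.
exists `|t| => y; rewrite iso_norm (le_trans (bop_normP _ _)) // ler_wpM2l //.
exact: coiso_norm.
Qed.

Definition inflate t : bop L := Bop (inflate_subproof t).

Lemma compress_subproof T : (fun x => coiso v (T (v x))) \in @bop_pred R K.
Proof.
apply/asboolP; split=> [a x y|]; first by rewrite !linearP.
exists `|T| => x; rewrite (le_trans (coiso_norm _)) // (le_trans (bop_normP _ _)) //.
by rewrite iso_norm.
Qed.

Definition compress T : bop K := Bop (compress_subproof T).

Lemma inflateK t : compress (inflate t) = t.
Proof. by apply: bop_ext => x /=; rewrite !isoK. Qed.

Lemma inflate_linear : linear inflate.
Proof. by move=> a s t; apply: bop_ext => y /=; rewrite /= !linearP. Qed.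

Lemma compress_linear : linear compress.
Proof. by move=> a S T; apply: bop_ext => x /=; rewrite /= !linearP. Qed.

HB.instance Definition _ :=
  GRing.isLinear.Build R[i] (bop K) (bop L) *:%R inflate inflate_linear.
HB.instance Definition _ :=
  GRing.isLinear.Build R[i] (bop L) (bop K) *:%R compress compress_linear.

Lemma compress_norm T : `|compress T| <= `|T|.
Proof.
apply: bop_norm_le => // x /=; rewrite (le_trans (coiso_norm _)) //.
by rewrite (le_trans (bop_normP _ _)) // iso_norm.
Qed.

Lemma inflate_norm t : `|inflate t| = `|t|.
Proof.
apply/eqP; rewrite eq_le; apply/andP; split; last first.
  by rewrite -[in leLHS](inflateK t) compress_norm.
apply: bop_norm_le => // y /=; rewrite iso_norm (le_trans (bop_normP _ _)) //.
by rewrite ler_wpM2l // coiso_norm.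
Qed.

Lemma compress_psd T : psd T -> psd (compress T).
Proof. by move=> Tp x /=; rewrite coiso_adj. Qed.

Lemma inflate_psd t : psd t -> psd (inflate t).
Proof. by move=> tp y /=; rewrite iso_adj. Qed.

End Isometries.

(** * Isometries at matrix level *)

Section Amplification.
Context (R : realType) (K L : hilbertType R) (v : hisometry K L) (d : nat).

Let hpow_map (A B : hilbertType R) (f : A -> B) (x : hpow A d) : hpow B d :=
  [ffun i => f (x i)].

Let hpow_map_linear (A B : hilbertType R) (f : {linear A -> B}) :
  linear (hpow_map f).
Proof. by move=> a x y; apply/ffunP => i; rewrite !ffunE linearP. Qed.

Let amp_fun : hpow K d -> hpow L d := hpow_map v.
Let amp_co : hpow L d -> hpow K d := hpow_map (coiso v).

HB.instance Definition _ :=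
  GRing.isLinear.Build R[i] _ _ *:%R amp_fun (hpow_map_linear v).
HB.instance Definition _ :=
  GRing.isLinear.Build R[i] _ _ *:%R amp_co (hpow_map_linear (coiso v)).

Let amp_adj x y : hdot (amp_fun x) y = hdot x (amp_co y).
Proof. by apply: eq_bigr => i _; rewrite !ffunE iso_adj. Qed.

Let ampK : cancel amp_fun amp_co.
Proof. by move=> x; apply/ffunP => i; rewrite !ffunE isoK. Qed.

Definition amplify : hisometry (hpow K d) (hpow L d) :=
  @HIsometry R _ _ amp_fun amp_co amp_adj ampK.

Lemma amplifyE x i : amplify x i = v (x i).
Proof. exact: ffunE. Qed.

Lemma coamplifyE y i : coiso amplify y i = coiso v (y i).
Proof. exact: ffunE. Qed.

(** Inflation of a matrix is inflation along the amplified isometry, and likewise for compression.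
    Statements about single operators, such as [inflate_psd] and [inflate_norm], thereby hold at
    every matrix level. *)
Lemma mx_op_inflate (a : 'M[bop K]_d) :
  mx_op (map_mx (inflate v) a) = inflate amplify (mx_op a).
Proof.
apply: bop_ext => x; apply/ffunP => i.
rewrite [RHS]amplifyE !ffunE linear_sum.
by apply: eq_bigr => j _; rewrite mxE /= coamplifyE.
Qed.

Lemma mx_op_compress (a : 'M[bop L]_d) :
  mx_op (map_mx (compress v) a) = compress amplify (mx_op a).
Proof.
apply: bop_ext => x; apply/ffunP => i.
rewrite [RHS]coamplifyE !ffunE linear_sum.
by apply: eq_bigr => j _; rewrite mxE /= amplifyE.
Qed.

End Amplification.

(** * Orthogonal direct sums of completely positive contractions *)

Section OrthogonalFamily.
Context (R : realType) (K L : hilbertType R) (N : nat) (w : 'I_N -> hisometry K L).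

Definition orthogonal_isometries : Prop :=
  forall j k x, j != k -> coiso (w j) (w k x) = 0.

Hypothesis w_orth : orthogonal_isometries.

Lemma orthogonal_sum_norm (y : 'I_N -> K) :
  `|\sum_k w k (y k)| ^+ 2 = \sum_k `|y k| ^+ 2.
Proof.
rewrite -hdot_norm hdot_suml; apply: eq_bigr => k _.
rewrite hdot_sumr (bigD1 k) //= big1 => [|j jk].
  by rewrite addr0 hdot_norm iso_norm.
by rewrite iso_adj w_orth ?hdot0r // eq_sym.
Qed.

(** Bessel's inequality: p is the projection of x onto the sum of the ranges, and the square of the
    norm of x - p is nonnegative. *)
Lemma orthogonal_bessel (x : L) : \sum_k `|coiso (w k) x| ^+ 2 <= `|x| ^+ 2.
Proof.
set p := \sum_k w k (coiso (w k) x).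
have pE : \sum_k `|coiso (w k) x| ^+ 2 = hdot p x.
  by rewrite hdot_suml; apply: eq_bigr => k _; rewrite iso_adj hdot_norm.
have pp : hdot p p = hdot p x by rewrite hdot_norm orthogonal_sum_norm pE.
have := hdot_ge0 (x - p); rewrite hdotBr !hdotBl pp (hdotC x p) -pp -hdotC subrr.
by rewrite subr0 subr_ge0 pE -pp [hdot x x]hdot_norm.
Qed.

Lemma sum_inflate_psd (s : 'I_N -> bop K) :
  (forall k, psd (s k)) -> psd (\sum_k inflate (w k) (s k)).
Proof.
move=> sp x; rewrite bop_sumE hdot_suml; apply: sumr_ge0 => k _.
exact: inflate_psd.
Qed.

(** The summands read from and write to orthogonal ranges, so the bound is the maximum of the norms
    instead of their sum. *)
Lemma sum_inflate_norm (s : 'I_N -> bop K) M :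
  0 <= M -> (forall k, `|s k| <= M) -> `|\sum_k inflate (w k) (s k)| <= M.
Proof.
move=> M0 sM; apply: bop_norm_le => // x.
rewrite -(@ler_pXn2r _ 2) ?nnegrE ?mulr_ge0 // bop_sumE orthogonal_sum_norm.
rewrite exprMn (le_trans _ (ler_wpM2l (exprn_ge0 2 M0) (orthogonal_bessel x))) //.
rewrite mulr_sumr; apply: ler_sum => k _.
rewrite -exprMn ler_pXn2r ?nnegrE ?mulr_ge0 // (le_trans (bop_normP _ _)) //.
by rewrite ler_wpM2r.
Qed.

End OrthogonalFamily.

Lemma orthogonal_amplify (R : realType) (K L : hilbertType R) N d
    (w : 'I_N -> hisometry K L) : orthogonal_isometries w ->
  orthogonal_isometries (fun k => amplify (w k) d).
Proof.
move=> wo j k x jk; apply/ffunP => i.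
by rewrite coamplifyE amplifyE wo // ffunE.
Qed.

Lemma mx_op_sum (R : realType) (K L : hilbertType R) N d
    (g : 'I_N -> bop K -> bop L) (a : 'M[bop K]_d) :
  mx_op (map_mx (fun T => \sum_k g k T) a) = \sum_k mx_op (map_mx (g k) a).
Proof.
apply: bop_ext => x; apply/ffunP => i; rewrite bop_sumE sum_ffunE ffunE.
under [RHS]eq_bigr do rewrite ffunE.
rewrite exchange_big /=; apply: eq_bigr => j _.
by rewrite mxE bop_sumE; apply: eq_bigr => k _; rewrite mxE.
Qed.

(** Both halves of the factorization in [tensor_c0_CPAP] have this shape, with the families [l2_iso]
    and [mx_block] exchanging the roles of [v] and [w]. At each matrix level the map is again a sum
    of inflations, along the amplified isometries. *)
Lemma cpcc_direct_sum (R : realType) (K0 L0 K1 L1 : hilbertType R) N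
    (v : 'I_N -> hisometry K0 L0) (w : 'I_N -> hisometry K1 L1)
    (E0 : set (bop K0)) (F0 : set (bop K1)) (E : set (bop L0)) (F : set (bop L1))
    (f : bop K0 -> bop K1) :
  orthogonal_isometries w -> cpcc_map E0 F0 f ->
  (forall k T, E T -> E0 (compress (v k) T)) ->
  (forall s, (forall k, F0 (s k)) -> F (\sum_k inflate (w k) (s k))) ->
  cpcc_map E F (fun T => \sum_k inflate (w k) (f (compress (v k) T))).
Proof.
move=> wo [f_lin f_in f_cp f_cc] vE wF.
have mx_opE d (a : 'M[bop L0]_d) :
    mx_op (map_mx (fun T => \sum_k inflate (w k) (f (compress (v k) T))) a) =
    \sum_k inflate (amplify (w k) d) (mx_op (map_mx f (map_mx (compress (v k)) a))).
  rewrite mx_op_sum; apply: eq_bigr => k _; rewrite -mx_op_inflate.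
  by rewrite -!map_mx_comp.
have inE d (a : 'M[bop L0]_d) k : mx_in E a -> mx_in E0 (map_mx (compress (v k)) a).
  by move=> aE i j; rewrite mxE; exact: vE.
split=> [a x y Ex Ey|x Ex|d a aE ap|d a aE].
- rewrite scaler_sumr -big_split /=; apply: eq_bigr => k _.
  by rewrite !linearP /= f_lin ?linearP //; exact: vE.
- by apply: wF => k; apply: f_in; exact: vE.
- rewrite mx_opE; apply: sum_inflate_psd => k; apply: f_cp; first exact: inE.
  by rewrite mx_op_compress; exact: compress_psd.
- rewrite mx_opE; apply: sum_inflate_norm => // [|k]; first exact: orthogonal_amplify.
  rewrite (le_trans (f_cc _ _ (inE _ _ _ aE))) // mx_op_compress.
  exact: compress_norm.
Qed.

Lemma compress_sum_inflate (R : realType) (K L : hilbertType R) N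
    (w : 'I_N -> hisometry K L) (s : 'I_N -> bop K) k :
  orthogonal_isometries w -> compress (w k) (\sum_j inflate (w j) (s j)) = s k.
Proof.
move=> wo; apply: bop_ext => x.
rewrite /= bop_sumE (bigD1 k) //= big1 ?addr0 ?isoK // => j jk.
by rewrite wo // !linear0.
Qed.

(** * Block embeddings between finite powers of a Hilbert space *)

Section CoordinateEmbedding.
Context (R : realType) (H : hilbertType R) (n m : nat) (f : 'I_n -> 'I_m).

(** For injective f this is extension by zero: the sum has at most one nonzero term and avoids
    naming an inverse of f. *)
Definition hpow_place (x : hpow H n) : hpow H m :=
  [ffun l => \sum_j if f j == l then x j else 0].

Definition hpow_pick (y : hpow H m) : hpow H n := [ffun j => y (f j)].

Lemma hpow_place_linear : linear hpow_place.
Proof.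
move=> a x y; apply/ffunP => l; rewrite !ffunE scaler_sumr -big_split /=.
by apply: eq_bigr => j _; rewrite !ffunE; case: ifP; rewrite ?scaler0 ?addr0.
Qed.

Lemma hpow_pick_linear : linear hpow_pick.
Proof. by move=> a x y; apply/ffunP => l; rewrite !ffunE. Qed.

HB.instance Definition _ :=
  GRing.isLinear.Build R[i] _ _ *:%R hpow_place hpow_place_linear.
HB.instance Definition _ :=
  GRing.isLinear.Build R[i] _ _ *:%R hpow_pick hpow_pick_linear.

Lemma hpow_place_adj x y : hdot (hpow_place x) y = hdot x (hpow_pick y).
Proof.
transitivity (\sum_l \sum_j if f j == l then hdot (x j) (y l) else 0).
  apply: eq_bigr => l _; rewrite ffunE hdot_suml; apply: eq_bigr => j _.
  by case: ifP => //; rewrite hdot0l.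
rewrite exchange_big /=; apply: eq_bigr => j _.
rewrite (bigD1 (f j)) //= eqxx ffunE big1 ?addr0 // => l.
by rewrite eq_sym => /negPf->.
Qed.

Lemma hpow_placeK : injective f -> cancel hpow_place hpow_pick.
Proof.
move=> fi x; apply/ffunP => j; rewrite !ffunE (bigD1 j) //= eqxx big1 ?addr0 //.
by move=> i /negPf ij; rewrite (inj_eq fi) ij.
Qed.

Definition hpow_iso (fi : injective f) : hisometry (hpow H n) (hpow H m) :=
  @HIsometry R _ _ hpow_place hpow_pick hpow_place_adj (hpow_placeK fi).

End CoordinateEmbedding.

Lemma mxvec_index_inj m n (i i' : 'I_m) (j j' : 'I_n) :
  mxvec_index i j = mxvec_index i' j' -> (i, j) = (i', j').
Proof. by move/cast_ord_inj/enum_rank_inj. Qed.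

Lemma mxvec_index_injr m n (i : 'I_m) : injective (@mxvec_index m n i).
Proof. by move=> j j' /mxvec_index_inj[]. Qed.

(** The k-th of m orthogonal copies of H^n in H^(mn); [mxvec_index] enumerates the pairs of block
    and position. *)
Definition mx_block (R : realType) (H : hilbertType R) m n (k : 'I_m) :
  hisometry (hpow H n) (hpow H (m * n)) := hpow_iso H (@mxvec_index_injr m n k).

Lemma mx_block_orth (R : realType) (H : hilbertType R) m n :
  orthogonal_isometries (@mx_block R H m n).
Proof.
move=> j k x jk; apply/ffunP => i; rewrite !ffunE big1 // => l _; case: eqP => //.
move=> /mxvec_index_inj[kj _].
by rewrite kj eqxx in jk.
Qed.

(** * One-by-one matrices and the scalar level *)

Section OneByOne.
Context (R : realType) (H : hilbertType R).

Let diag1 (x : H) : hpow H 1 := [ffun=> x].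
Let eval1 (x : hpow H 1) : H := x ord0.

Let diag1_linear : linear diag1.
Proof. by move=> a x y; apply/ffunP => l; rewrite !ffunE. Qed.

Let eval1_linear : linear eval1.
Proof. by move=> a x y; rewrite /eval1 !ffunE. Qed.

HB.instance Definition _ := GRing.isLinear.Build R[i] _ _ *:%R diag1 diag1_linear.
HB.instance Definition _ := GRing.isLinear.Build R[i] _ _ *:%R eval1 eval1_linear.

Let diag1_adj x y : hdot (diag1 x) y = hdot x (eval1 y).
Proof. by rewrite /hdot /= /hpow_dot big_ord1 ffunE. Qed.

Let diag1K : cancel diag1 eval1.
Proof. by move=> x; rewrite /eval1 ffunE. Qed.

Definition iso1 : hisometry H (hpow H 1) :=
  @HIsometry R _ _ diag1 eval1 diag1_adj diag1K.

Lemma mx_op_const1 (T : bop H) : mx_op (const_mx T : 'M_1) = inflate iso1 T.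
Proof.
apply: bop_ext => x; apply/ffunP => i; rewrite !ffunE big_ord1 mxE.
by rewrite /= /eval1.
Qed.

End OneByOne.

Section ScalarLevel.
Context (R : realType) (H K : hilbertType R) (E : set (bop H)).
Variable f : bop H -> bop K.

Lemma mx_in_const1 T : E T -> mx_in E (const_mx T : 'M_1).
Proof. by move=> ET i j; rewrite mxE. Qed.

Lemma completely_positive1 T :
  completely_positive E f -> E T -> psd T -> psd (f T).
Proof.
move=> fp ET Tp; have := fp 1%N _ (mx_in_const1 ET).
rewrite map_const_mx !mx_op_const1 => /(_ (inflate_psd _ Tp)).
by move/(compress_psd (iso1 K)); rewrite inflateK.
Qed.

Lemma completely_contractive1 T :
  completely_contractive E f -> E T -> `|f T| <= `|T|.
Proof.
move=> fc ET; have := fc 1%N _ (mx_in_const1 ET).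
by rewrite map_const_mx !mx_op_const1 !inflate_norm.
Qed.

Lemma completely_isometric1 T :
  completely_isometric E f -> E T -> `|f T| = `|T|.
Proof.
move=> fc ET; have := fc 1%N _ (mx_in_const1 ET).
by rewrite map_const_mx !mx_op_const1 !inflate_norm.
Qed.

End ScalarLevel.

(** * Elements of the tensor product as block diagonal operators *)

Section Blocks.
Context (R : realType) (H : hilbertType R).
Implicit Types (S T : bop (l2 H)) (t : bop H).

Lemma l2_place_subproof k (x : H) :
  (fun n => if n == k then x else 0) \in @l2_pred R H.
Proof.
apply/l2_predP; exists (`|x| ^+ 2) => n.
rewrite (bigID (fun i : 'I_n => i == k :> nat)) /= [X in _ + X]big1 => [|i /negPf->].
  rewrite addr0; case: (ltnP k n) => kn.
    by rewrite (big_pred1 (Ordinal kn)) /= ?eqxx.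
  rewrite big_pred0 ?exprn_ge0 // => i.
  by apply/negP => /eqP ik; move: (ltn_ord i); rewrite ik ltnNge kn.
by rewrite normr0 expr0n.
Qed.

Definition l2_place k (x : H) : l2 H := L2 (l2_place_subproof k x).
Definition l2_coord k (x : l2 H) : H := x k.

Lemma l2_place_linear k : linear (l2_place k).
Proof.
move=> a x y; apply: l2_ext => n; rewrite l2_linE /=.
by case: ifP; rewrite ?scaler0 ?addr0.
Qed.

Lemma l2_coord_linear k : linear (l2_coord k).
Proof. by []. Qed.

HB.instance Definition _ k :=
  GRing.isLinear.Build R[i] _ _ *:%R (l2_place k) (l2_place_linear k).
HB.instance Definition _ k :=
  GRing.isLinear.Build R[i] _ _ *:%R (l2_coord k) (l2_coord_linear k).

Lemma l2_place_adj k x y : hdot (l2_place k x) y = hdot x (l2_coord k y).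
Proof.
apply: l2_dotP; apply: (@cvg_near_cst _ R[i]^o).
exists k.+1 => // n /= kn; rewrite seriesEord /=.
rewrite (bigD1 (Ordinal kn)) //= eqxx big1 ?addr0 // => i.
by rewrite -val_eqE /= => /negPf->; rewrite hdot0l.
Qed.

Lemma l2_placeK k : cancel (l2_place k) (l2_coord k).
Proof. by move=> x; rewrite /l2_coord /= eqxx. Qed.

Definition l2_iso k : hisometry H (l2 H) :=
  @HIsometry R _ _ (l2_place k) (l2_coord k) (@l2_place_adj k) (@l2_placeK k).

Lemma l2_iso_orth N : orthogonal_isometries (fun k : 'I_N => l2_iso k).
Proof.
by move=> j k x; rewrite -val_eqE /= /l2_coord /= => /negPf->.
Qed.

(** The k-th block of an operator acting coordinatewise is forced to be its k-th compression, so no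
    separate family of blocks is carried. *)
Definition block_diagonal T := forall x k, T x k = compress (l2_iso k) T (x k).

Lemma l2_coord_norm (x : l2 H) k : `|x k| <= `|x|.
Proof. exact: (coiso_norm (l2_iso k)). Qed.

Lemma block_diagonal_lin a S T :
  block_diagonal S -> block_diagonal T -> block_diagonal (a *: S + T).
Proof.
move=> Sd Td x k; rewrite linearP /= [LHS](_ : _ = a *: S x k + T x k) //.
by rewrite Sd Td.
Qed.

(** The defect T x k - [compress (l2_iso k) T (x k)] is linear in T, vanishes at S, and is therefore
    controlled by the norm of T - S. *)
Lemma block_diagonal_lim T :
  (forall e : R[i], 0 < e -> exists2 S, block_diagonal S & `|T - S| < e) ->
  block_diagonal T.
Proof.
move=> Tlim x k; apply/eqP; rewrite -subr_eq0 -normr_le0.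
apply/ler_addgt0Pl => e e0; rewrite addr0.
(* The defect is at most 2 |T - S| |x|; adding 1 keeps the divisor positive. *)
pose c := (`|x| + 1) *+ 2.
have c0 : 0 < c by rewrite pmulrn_lgt0 // ltr_wpDl.
have [S Sd TS] := Tlim (e / c) (divr_gt0 e0 c0).
have -> : T x k - compress (l2_iso k) T (x k) =
    (T - S) x k - compress (l2_iso k) (T - S) (x k).
  rewrite [RHS](_ : _ = (T x k - S x k) -
    (compress (l2_iso k) T (x k) - compress (l2_iso k) S (x k))) //.
  by rewrite Sd opprB addrA subrK.
rewrite (le_trans (ler_normB _ _)) //.
apply: (@le_trans _ _ (`|T - S| * `|x| *+ 2)).
  rewrite mulr2n; apply: lerD.
    exact: le_trans (l2_coord_norm _ _) (bop_normP _ _).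
  rewrite (le_trans (bop_normP _ _)) //; apply: ler_pM => //.
    exact: compress_norm.
  exact: l2_coord_norm.
rewrite -mulrnAr (@le_trans _ _ (`|T - S| * c)) //.
  by rewrite ler_wpM2l // lerMn2r lerDl ler01.
by rewrite -ler_pdivlMr // ltW.
Qed.

Lemma block_diagonal_norm T M : block_diagonal T -> 0 <= M ->
  (forall k, `|compress (l2_iso k) T| <= M) -> `|T| <= M.
Proof.
move=> Td M0 TM; apply: bop_norm_le => // x.
rewrite -(@ler_pXn2r _ 2) ?nnegrE ?mulr_ge0 // -hdot_norm exprMn.
apply: l2_dot_le => n.
apply: (@le_trans _ _ (M ^+ 2 * \sum_(k < n) `|x k| ^+ 2)); last first.
  by rewrite ler_wpM2l ?exprn_ge0 // -hdot_norm; exact: l2_dot_ge.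
rewrite mulr_sumr; apply: ler_sum => k _; rewrite Td -exprMn.
rewrite ler_pXn2r ?nnegrE ?mulr_ge0 // (le_trans (bop_normP _ _)) //.
by rewrite ler_wpM2r.
Qed.

Lemma compress_inflate_l2 k n t :
  compress (l2_iso n) (inflate (l2_iso k) t) = if n == k then t else 0.
Proof.
by apply: bop_ext => x; rewrite /= /l2_coord /=; case: eqP => [->|] //; rewrite eqxx.
Qed.

Lemma c0_delta_subproof k : (fun n => (n == k)%:R : R[i]^o) @ \oo --> (0 : R[i]^o).
Proof.
apply: (@cvg_near_cst _ R[i]^o); exists k.+1 => // n /= kn.
by rewrite gtn_eqF.
Qed.

Definition c0_delta k : c0 R := C0 (c0_delta_subproof k).

(** Operators supported on one block are elementary tensors; this is how copies of E enter
    [tensor_c0 E]. *)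
Lemma tens_op_delta t k : tens_op t (c0_delta k) = inflate (l2_iso k) t.
Proof.
apply: bop_ext => x; apply: l2_ext => n; rewrite /= /tens_fun /= /l2_coord.
by case: eqP => [->|_]; rewrite ?scale1r ?scale0r.
Qed.

Lemma compress_tens_op t (f : c0 R) k :
  compress (l2_iso k) (tens_op t f) = f k *: t.
Proof.
by apply: bop_ext => x; rewrite /= /l2_coord /= /tens_fun /= eqxx.
Qed.

End Blocks.

(** * Blocks of elements of the tensor product: they lie in E and tend to 0 *)

Section TensorC0.
Context (R : realType) (H : hilbertType R) (E : set (bop H)).
Hypothesis opsysE : operator_system E.
Implicit Types (S T : bop (l2 H)) (t : bop H).

Lemma tensor_c0_inflate k t : E t -> tensor_c0 E (inflate (l2_iso H k) t).
Proof.
move=> Et; rewrite -tens_op_delta; apply: subset_closure.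
exists 1%N, (fun=> 1), (fun=> tens_op t (c0_delta R k)).
by split=> [_|]; [exists t => //; exists (c0_delta R k) | rewrite big_ord1 scale1r].
Qed.

(** Induction over a closed linear span: elementary tensors, linear combinations, norm limits. *)
Lemma tensor_c0_ind (P : bop (l2 H) -> Prop) :
  P 0 -> (forall a S T, P S -> P T -> P (a *: S + T)) ->
  (forall t f, E t -> P (tens_op t f)) ->
  (forall T, (forall e : R[i], 0 < e -> exists2 S, P S & `|T - S| < e) -> P T) ->
  forall T, tensor_c0 E T -> P T.
Proof.
move=> P0 Plin Pten Plim T /closure_normP ET; apply: Plim => e /ET[S SE TS].
exists S => //; case: SE => n [a [s [sE ->]]].
elim/big_rec : _ => // i x _ Px; apply: Plin => //.
by have [t Et [f _ <-]] := sE i; exact: Pten.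
Qed.

Lemma tensor_c0_diagonal T : tensor_c0 E T -> block_diagonal T.
Proof.
apply: tensor_c0_ind T => [x k|||T].
- by rewrite linear0.
- exact: block_diagonal_lin.
- by move=> t f _ x k; rewrite compress_tens_op.
- exact: block_diagonal_lim.
Qed.

Lemma tensor_c0_compress k T : tensor_c0 E T -> E (compress (l2_iso H k) T).
Proof.
have [Ecl E0 Elin _] := opsysE.
move: T; apply: (@tensor_c0_ind (fun T => E (compress (l2_iso H k) T)))
  => [|a S T ES ET|t f Et|T Tlim].
- by rewrite linear0.
- by rewrite linearP; exact: Elin.
- by rewrite compress_tens_op -[_ *: _]addr0; exact: Elin.
- apply: Ecl; apply/closure_normP => e /Tlim[S ES TS].
  exists (compress (l2_iso H k) S) => //.
  by rewrite -linearB (le_lt_trans (compress_norm _ _)).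
Qed.

(** The blocks of an elementary tensor are f_k t with f_k tending to 0. Since compression is linear
    and contractive, the property passes to combinations and limits. *)
Lemma tensor_c0_vanish T : tensor_c0 E T -> forall e : R[i], 0 < e ->
  exists N, forall k, (N <= k)%N -> `|compress (l2_iso H k) T| < e.
Proof.
move: T; apply: (@tensor_c0_ind (fun T => forall e : R[i], 0 < e ->
    exists N, forall k, (N <= k)%N -> `|compress (l2_iso H k) T| < e))
  => [e e0|a S T ES ET e e0|t f Et e e0|T Tlim e e0].
- by exists 0%N => k _; rewrite linear0 normr0.
- have a1 : 0 < `|a| + 1 by rewrite ltr_wpDl.
  have e2 : 0 < e / 2 by rewrite divr_gt0 // ltr0n.
  have [N1 N1P] := ES (e / 2 / (`|a| + 1)) (divr_gt0 e2 a1).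
  have [N2 N2P] := ET _ e2.
  exists (maxn N1 N2) => k; rewrite geq_max => /andP[k1 k2].
  rewrite linearP (le_lt_trans (ler_normD _ _)) // (splitr e).
  apply: ler_ltD; last exact: N2P.
  rewrite normrZ (@le_trans _ _ ((`|a| + 1) * `|compress (l2_iso H k) S|)) //.
    by rewrite ler_wpM2r // lerDl.
  by rewrite -ler_pdivlMl // mulrC ltW // N1P.
- have t1 : 0 < `|t| + 1 by rewrite ltr_wpDl.
  have /cvgrPdist_lt/(_ _ (divr_gt0 e0 t1))[N _ fN] := @c0_lim R f.
  exists N => k Nk; rewrite compress_tens_op normrZ.
  have := fN k Nk; rewrite /= sub0r normrN => fk.
  rewrite (@le_lt_trans _ _ (`|f k| * (`|t| + 1))) //.
    by rewrite ler_wpM2l // lerDl.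
  by rewrite -ltr_pdivlMr.
- have e2 : 0 < e / 2 by rewrite divr_gt0 // ltr0n.
  have [S SP TS] := Tlim _ e2; have [N NP] := SP _ e2.
  exists N => k /NP SN; rewrite -[T](subrK S) linearD (le_lt_trans (ler_normD _ _)) //.
  by rewrite (splitr e) ltrD // (le_lt_trans (compress_norm _ _)).
Qed.

Lemma tensor_c0_sum n (k : 'I_n -> nat) (s : 'I_n -> bop H) :
  (forall i, E (s i)) -> tensor_c0 E (\sum_i inflate (l2_iso H (k i)) (s i)).
Proof.
move=> sE; have [_ F0 Flin _] := tensor_c0_operator_system opsysE.
elim/big_rec : _ => // i x _ Fx; rewrite -[inflate _ _]scale1r; apply: Flin => //.
exact: tensor_c0_inflate.
Qed.

End TensorC0.

(** * Approximation property *)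

Lemma net_cvgP (R : realType) (V : normedModType R[i]) (I : Type)
    (le : I -> I -> Prop) (f : I -> V) (x : V) :
  f i @[i --> net_filter le] --> x <->
  forall e : R[i], 0 < e -> exists i0, forall i, le i0 i -> `|x - f i| < e.
Proof.
split=> [fx e e0|fx A /nbhs_ballP[e /= e0 eA]].
  have [i0 i0P] := fx _ (nbhsx_ballx x e e0); exists i0 => i /i0P.
  by rewrite /= -ball_normE.
have [i0 i0P] := fx e e0; exists i0 => i /i0P xi; apply: eA.
by rewrite -ball_normE.
Qed.

(** Finitely many eventual conditions share an index because any two indices have an upper bound. *)
Lemma directed_forall (I : Type) (le : I -> I -> Prop) N
    (P : nat -> I -> Prop) : directed le ->
  (forall k, exists i0, forall i, le i0 i -> P k i) ->
  exists i0, forall i, le i0 i -> forall k, (k < N)%N -> P k i.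
Proof.
move=> [[i1 _] _ tr up] Pk; elim: N => [|N [i IH]]; first by exists i1.
have [j jP] := Pk N; have [k ik jk] := up i j; exists k => l kl m.
rewrite ltnS leq_eqVlt => /orP[/eqP->|]; first exact/jP/(tr _ _ _ jk).
by apply/IH/(tr _ _ _ ik).
Qed.

Lemma compress_sum_l2 (R : realType) (H : hilbertType R) N (s : nat -> bop H) n :
  compress (l2_iso H n) (\sum_(k < N) inflate (l2_iso H k) (s k)) =
  if (n < N)%N then s n else 0.
Proof.
rewrite linear_sum /=; under eq_bigr do rewrite compress_inflate_l2.
case: ltnP => nN.
  rewrite (bigD1 (Ordinal nN)) //= eqxx big1 ?addr0 // => k.
  by rewrite -val_eqE eq_sym /= => /negPf->.
by rewrite big1 // => k _; rewrite gtn_eqF // (leq_trans (ltn_ord k)).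
Qed.

Lemma tensor_c0_CPAP (R : realType) (H : hilbertType R) (E : set (bop H)) :
  operator_system E -> CPAP E -> CPAP (tensor_c0 E).
Proof.
move=> opsysE [I [le [n [psi [phi [dle n1 psiP phiP cv]]]]]].
(* A pair (i, M) uses the i-th factorization of E on blocks 0 to M; taking M + 1 blocks keeps the
   matrix size positive. *)
exists (I * nat)%type, (fun p q => le p.1 q.1 /\ (p.2 <= q.2)%N),
  (fun p => p.2.+1 * n p.1)%N,
  (fun p T => \sum_(k < p.2.+1) inflate (mx_block (cline R) (n p.1) k)
     (psi p.1 (compress (l2_iso H k) T))),
  (fun p S => \sum_(k < p.2.+1) inflate (l2_iso H k)
     (phi p.1 (compress (mx_block (cline R) (n p.1) k) S))).
have [[i1 _] rf tr up] := dle.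
split=> [|p|p|p|T FT].
- split; first by exists (i1, 0%N).
  + by move=> p; split.
  + move=> p q r [pq pq2] [qr qr2]; split; first exact: tr qr.
    exact: leq_trans qr2.
  + move=> p q; have [i pi qi] := up p.1 q.1.
    by exists (i, maxn p.2 q.2); split; rewrite //= ?leq_maxl ?leq_maxr.
- by rewrite muln_gt0 /= n1.
- apply: (cpcc_direct_sum (v := fun k : 'I_p.2.+1 => l2_iso H k)
    (@mx_block_orth _ _ _ _) (psiP p.1)) => // k T.
  exact: tensor_c0_compress.
- apply: (cpcc_direct_sum (@l2_iso_orth _ _ _) (phiP p.1)) => // s sE.
  exact: tensor_c0_sum.
apply/net_cvgP => e e0.
pose t k := compress (l2_iso H k) T.
have tE k : E (t k) by exact: tensor_c0_compress.
have e2 : 0 < e / 2 by rewrite divr_gt0 // ltr0n.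
have e4 : 0 < e / 2 / 2 by rewrite divr_gt0 // ltr0n.
(* Blocks from N on have norm below e/4; [i0] then handles the finitely many blocks before N to
   within e/2. *)
have [N tN] := tensor_c0_vanish FT e4.
have [i0 i0P] := directed_forall N dle
  (fun k => (proj1 (net_cvgP le _ (t k))) (cv _ (tE k)) _ e2).
exists (i0, N) => -[i M] [/= i0i NM].
(* Orthogonality of the matrix blocks cancels the middle of the composite, which leaves
   [phi i (psi i (t k))] in block k. *)
under eq_bigr do rewrite (compress_sum_inflate _ _ (@mx_block_orth _ _ _ _)).
have [_ _ psi_cp psi_cc] := psiP i; have [_ phi_in phi_cp phi_cc] := phiP i.
pose s k := phi i (psi i (t k)).
have sE k : E (s k) by exact: phi_in.
set D := \sum_k _.
have FTD : tensor_c0 E (T - D).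
  have [_ _ Flin _] := tensor_c0_operator_system opsysE.
  rewrite addrC -scaleN1r; apply: Flin => //.
  exact: (tensor_c0_sum opsysE (k := fun j : 'I_M.+1 => j) (s := fun j => s j)).
apply: (@le_lt_trans _ _ (e / 2)); last first.
  by rewrite ltr_pdivrMr ?ltr0n // ltr_pMr // ltr1n.
(* The error is block diagonal, so each block is bounded separately. For k > M the approximant is 0
   and the block of T is small. For k < N the choice of [i0] applies. In between, both blocks have
   norm at most e/4 by contractivity. *)
apply: block_diagonal_norm (ltW e2) _ => [|k]; first exact: tensor_c0_diagonal FTD.
rewrite linearB /= (compress_sum_l2 _ s) -/(t k).
have [kM|Mk] := ltnP k M.+1; last first.
  rewrite subr0 (le_trans (ltW (tN k _))) ?(leq_trans NM (ltnW Mk)) //.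
  by rewrite ler_pdivrMr ?ltr0n // ler_peMr ?ler1n ?(ltW e2).
have [kN|Nk] := ltnP k N; first exact/ltW/i0P.
rewrite (le_trans (ler_normB _ _)) // [leRHS]splitr.
apply: lerD; first exact/ltW/tN.
rewrite (le_trans (completely_contractive1 phi_cc _)) //.
by rewrite (le_trans (completely_contractive1 psi_cc _)) // ltW // tN.
Qed.

(** * Corners *)

Section Corners.
Context (R : realType) (K : hilbertType R).
Implicit Types (p b T : bop K) (E A : set (bop K)).

Definition projection p : Prop := psd p /\ forall x, p (p x) = p x.

Definition cutdown p b : bop K := bop_comp p (bop_comp b p).

Definition corner E p : set (bop K) := [set b | E b /\ cutdown p b = b].

Lemma eq_hdotr (x y : K) : (forall z, hdot z x = hdot z y) -> x = y.
Proof. by move=> xy; apply: eq_hdotl => z; rewrite hdotC xy -hdotC. Qed.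

Lemma cutdown_linear p : linear (cutdown p).
Proof. by move=> a b c; apply: bop_ext => x /=; rewrite linearP. Qed.

HB.instance Definition _ p :=
  GRing.isLinear.Build R[i] (bop K) (bop K) *:%R (cutdown p) (cutdown_linear p).

Lemma cutdown_norm p b : `|cutdown p b| <= `|p| * `|b| * `|p|.
Proof.
apply: bop_norm_le => [|x]; first by rewrite !mulr_ge0.
rewrite /= (le_trans (bop_normP _ _)) // -!mulrA ler_wpM2l //.
by rewrite (le_trans (bop_normP _ _)) // ler_wpM2l // bop_normP.
Qed.

Lemma projection_hdot p x : projection p -> hdot (p x) x = `|p x| ^+ 2.
Proof.
by move=> [pp idp]; rewrite -hdot_norm -[in LHS]idp (psd_adjoint pp).
Qed.

Lemma projection_cut p b x : (forall x, p (p x) = p x) -> cutdown p b = b ->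
  p (b x) = b x /\ b (p x) = b x.
Proof. by move=> idp <- /=; rewrite !idp. Qed.

(** As b = p b p, the form of b at x is its form at p x, which is at least -|b| |p x|^2, and |p x|^2
    is the form of p at x. *)
Lemma corner_dominated p b : projection p -> cutdown p b = b ->
  is_adjoint b b -> psd (`|b| *: p + b).
Proof.
move=> pr pb bb x; have [pp idp] := pr.
have -> : hdot ((`|b| *: p + b) x) x = `|b| * `|p x| ^+ 2 + hdot (b (p x)) (p x).
  rewrite bopDE bopZE hdotDl hdotZl projection_hdot //; congr (_ + _).
  by rewrite -[in LHS]pb /= (psd_adjoint pp).
have br : hdot (b (p x)) (p x) \is Num.real by rewrite CrealE -hdotC bb.
rewrite -[hdot (b _) _]opprK subr_ge0 (le_trans (real_ler_norm _)) ?rpredN //.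
rewrite normrN (le_trans (hdot_CauchySchwarz _ _)) // expr2 mulrA ler_wpM2r //.
exact: bop_normP.
Qed.

(** Domination makes b vanish on the kernel of p, so b = b p; self-adjointness of c p + b and of p
    moves this to the left side. *)
Lemma dominated_corner p b (c : R[i]) : projection p ->
  psd (c *: p + b) -> psd (c *: p - b) -> cutdown p b = b.
Proof.
move=> [pp idp] p1 p2.
have q0 x : p (x - p x) = 0 by rewrite linearB /= idp subrr.
have b0 x : b (x - p x) = 0.
  by apply: dominated_ker p1 p2 _; rewrite bopZE q0 scaler0.
have bp x : b (p x) = b x.
  by have /eqP := b0 x; rewrite linearB subr_eq0 => /eqP/esym.
apply: bop_ext => x /=; rewrite bp; apply/esym/eqP; rewrite -subr_eq0; apply/eqP.
apply: eq_hdotl => y; rewrite hdot0l hdotBl (psd_adjoint pp) -hdotBr.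
have -> : b x = (c *: p + b) x - c *: p x by rewrite bopDE addrC addKr.
have Tq : (c *: p + b) (y - p y) = 0 by rewrite bopDE bopZE q0 b0 scaler0 addr0.
rewrite hdotBl (psd_adjoint p1 x) Tq hdotZl (psd_adjoint pp x) q0.
by rewrite !hdot0r mulr0 subr0.
Qed.

Lemma corner_operator_system E p :
  operator_system E -> projection p -> operator_system (corner E p).
Proof.
move=> [Ecl E0 Elin Eadj] [pp idp]; split.
- move=> b /closure_normP cb; split.
    apply: Ecl; apply/closure_normP => e /cb[c [Ec _] bc].
    by exists c.
  apply/eqP; rewrite -subr_eq0 -normr_le0; apply/ler_addgt0Pl => e e0.
  (* M bounds the norm of the map taking b to p b p - b, which vanishes on the corner. *)
  rewrite addr0; pose M := `|p| * `|p| + 1.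
  have M0 : 0 < M by rewrite ltr_wpDl // mulr_ge0.
  have [c [_ pc] bc] := cb _ (divr_gt0 e0 M0).
  have -> : cutdown p b - b = cutdown p (b - c) - (b - c).
    by rewrite linearB /= pc opprB addrA subrK.
  rewrite (le_trans (ler_normB _ _)) //.
  apply: (@le_trans _ _ (`|b - c| * M)); last by rewrite -ler_pdivlMr // ltW.
  rewrite mulrDr mulr1 lerD2r (le_trans (cutdown_norm _ _)) //.
  by rewrite mulrA [`|b - c| * _]mulrC.
- by split=> //; rewrite linear0.
- move=> a b c [Eb pb] [Ec pc]; split; first exact: Elin.
  by rewrite linearP /= pb pc.
move=> b [Eb pb]; have [c Ec bc] := Eadj b Eb; exists c => //; split=> //.
apply: bop_ext => x; apply: eq_hdotr => y /=.
by rewrite -(psd_adjoint pp) -bc -(psd_adjoint pp) -bc -[in RHS]pb.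
Qed.

Lemma corner_cstar A p :
  cstar_algebra A -> projection p -> cstar_algebra (corner A p).
Proof.
move=> [opA Am] pr; split; first exact: corner_operator_system.
move=> b c [Ab pb] [Ac pc]; split; first exact: Am.
have [_ idp] := pr; apply: bop_ext => x /=.
have [-> _] := projection_cut (c (p x)) idp pb.
by have [_ ->] := projection_cut x idp pc.
Qed.

(** With c the adjoint of b, both b + c and i (b - c) are self-adjoint elements of E, and they span
    b. *)
Lemma operator_system_selfadj_ind E (P : bop K -> Prop) :
  operator_system E ->
  (forall a b c, E b -> E c -> P b -> P c -> P (a *: b + c)) ->
  (forall b, E b -> is_adjoint b b -> P b) -> forall b, E b -> P b.
Proof.
move=> [_ E0 Elin Eadj] Plin Psa b Eb; have [c Ec bc] := Eadj b Eb.
have cb : is_adjoint c b by move=> x y; rewrite hdotC -bc -hdotC.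
have ED : E (b + c) by rewrite -[b]scale1r; exact: Elin.
have EB : E ('i%C *: (b - c)).
  by rewrite -[_ *: _]addr0; apply: (Elin) => //; rewrite addrC -scaleN1r; exact: Elin.
have PD : P (b + c).
  by apply: Psa => // x y; rewrite !bopDE hdotDl hdotDr bc cb addrC.
have PB : P ('i%C *: (b - c)).
  apply: Psa => // x y; rewrite !bopZE !bopBE hdotZl hdotZr hdotBl hdotBr bc cb.
  by rewrite conjCi mulNr -mulrN opprB.
(* The trailing 0 allows [Plin] to be applied twice. *)
have -> : b = 2^-1 *: (b + c) + ((- 'i%C / 2) *: ('i%C *: (b - c)) + 0).
  rewrite addr0 scalerA mulrAC mulNr -expr2 sqrCi opprK mul1r -scalerDr.
  rewrite addrACA subrr addr0 -mulr2n.
  by rewrite -[b *+ 2]scaler_nat scalerA mulVf ?pnatr_eq0 // scale1r.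
have P0 : P 0 by apply: Psa => // x y; rewrite hdot0l hdot0r.
by apply: (Plin _ _ (_ *: _ + 0)) => //; [exact: Elin | exact: Plin].
Qed.

End Corners.

Lemma projection_norm (R : realType) (K : hilbertType R) (p : bop K) :
  projection p -> `|p| <= 1.
Proof.
move=> [pp idp]; apply: psd_norm_le1 => // x.
have -> : hdot ((bop_id K - p) x) x = hdot (x - p x) (x - p x).
  rewrite bopBE [RHS]hdotBr -(psd_adjoint pp (x - p x)) linearB /= idp subrr.
  by rewrite hdot0l subr0.
exact: hdot_ge0.
Qed.

Lemma range_projection (R : realType) (K L : hilbertType R) (v : hisometry K L) :
  projection (inflate v (bop_id K)).
Proof.
split=> [|x]; last by rewrite /= isoK.
by apply: inflate_psd => x; exact: hdot_ge0.
Qed.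

Section LinearOn.
Context (R : realType) (H K : hilbertType R) (E : set (bop H)).
Context (f : bop H -> bop K).
Hypotheses (opE : operator_system E) (f_lin : linear_on E f).

Lemma opsysB a x y : E x -> E y -> E (a *: x - y).
Proof.
move=> Ex Ey; have [_ E0 Elin _] := opE.
rewrite addrC -scaleN1r; apply: (Elin) => //.
by rewrite -[_ *: _]addr0; exact: Elin.
Qed.

Lemma linear_onB a x y : E x -> E y -> f (a *: x - y) = a *: f x - f y.
Proof.
move=> Ex Ey; have [_ E0 Elin _] := opE.
have f0 : f 0 = 0.
  by have := f_lin (-1) E0 E0; rewrite !scaleN1r !addNr.
have Ex' : E (a *: x) by rewrite -[_ *: _]addr0; exact: Elin.
rewrite addrC -scaleN1r f_lin // scaleN1r addrC; congr (_ - _).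
by rewrite -[in LHS](addr0 (a *: x)) f_lin // f0 addr0.
Qed.

(* Self-adjoint elements of the corner of p are those dominated by a multiple
   of p, a condition on the order alone. *)
Lemma corner_map p x : completely_positive E f -> E p ->
  projection p -> projection (f p) -> corner E p x -> cutdown (f p) (f x) = f x.
Proof.
move=> f_cp Ep pr fpr; have [_ _ Elin _] := opE.
have opC := corner_operator_system opE pr.
move: x; apply: (operator_system_selfadj_ind
    (P := fun x => cutdown (f p) (f x) = f x) opC)
  => [a b c [Eb _] [Ec _] fb fc|b [Eb pb] bb].
  by rewrite f_lin // linearP /= fb fc.
have bn : cutdown p (- b) = - b by rewrite linearN /= pb.
have bbn : is_adjoint (- b) (- b).
  by move=> x y; rewrite [LHS]hdotNl bb [RHS]hdotNr.
have d1 := completely_positive1 f_cp (Elin `|b| _ _ Ep Eb) (corner_dominated pr pb bb).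
have d2 := corner_dominated pr bn bbn; rewrite normrN in d2.
have d3 := completely_positive1 f_cp (opsysB `|b| Ep Eb) d2.
by apply: (@dominated_corner _ _ _ _ `|b|); rewrite -?f_lin -?linear_onB.
Qed.

End LinearOn.

(** * Isomorphisms onto C*-algebras preserve projections *)

Section IsoToCstar.
Context (R : realType) (H K : hilbertType R) (F : set (bop H)) (A : set (bop K)).
Context (phi : bop H -> bop K) (psi : bop K -> bop H).
Hypotheses (opF : operator_system F) (cstA : cstar_algebra A).
Hypotheses (phi_lin : linear_on F phi)
  (phi_in : forall x, F x -> A (phi x) /\ psi (phi x) = x)
  (psi_in : forall y, A y -> F (psi y) /\ phi (psi y) = y)
  (phi_iso : completely_isometric F phi)
  (phi_cp : completely_positive F phi) (psi_cp : completely_positive A psi).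

Lemma iso_inverse_linear : linear_on A psi.
Proof.
move=> a x y /psi_in[Fx {1}<-] /psi_in[Fy {1}<-]; rewrite -phi_lin //.
by apply: (proj2 (phi_in _)); have [_ _ Flin _] := opF; exact: Flin.
Qed.

(* For u := phi e, the element 2u - u^2 is positive, of norm at most 1 and at
   most 2u. Its preimage has the same properties relative to e, hence is at
   most e; so 2u - u^2 <= u, which forces u = u^2. *)
Lemma iso_projection e : F e -> projection e -> projection (phi e).
Proof.
move=> Fe pr; have [ep ide] := pr; have [opA Am] := cstA.
have [Au psiu] := phi_in Fe; set u := phi e in Au psiu *.
have up : psd u by exact: completely_positive1 phi_cp Fe ep.
have u1 : psd (bop_id K - u).
  apply: bop_norm_psd => //.
  by rewrite (completely_isometric1 phi_iso) ?projection_norm.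
pose w := bop_comp u u; have Aw : A w by exact: Am.
have wE x : hdot (w x) x = `|u x| ^+ 2.
  by rewrite /= (psd_adjoint up) hdot_norm.
have wp : psd w by move=> x; rewrite wE exprn_ge0.
have uw : psd (u - w).
  by move=> x; rewrite bopBE hdotBl wE subr_ge0; exact: psd_contraction.
pose z := 2 *: u - w; have Az : A z by exact: opsysB.
have zE : z = u + (u - w) by rewrite addrA -mulr2n -scaler_nat.
have zp : psd z by rewrite zE; exact: psdD.
have z1 : psd (bop_id K - z).
  (* 1 - z = (1 - u)^2. *)
  move=> x; rewrite (_ : hdot _ _ = hdot (x - u x) (x - u x)) ?hdot_ge0 //.
  rewrite !bopBE bopZE !hdotBl hdotZl !hdotBr wE -hdot_norm (psd_adjoint up x).
  by rewrite /=; ring.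
have [Fz phiz] := psi_in Az.
have z'p : psd (psi z) by exact: completely_positive1 psi_cp Az zp.
have z'1 : psd (bop_id H - psi z).
  apply: bop_norm_psd => //.
  rewrite -(completely_isometric1 phi_iso Fz) phiz; exact: psd_norm_le1.
have z'e : psd (2 *: e - psi z).
  rewrite -{1}psiu -(linear_onB opA iso_inverse_linear) //.
  apply: (completely_positive1 psi_cp); first exact: opsysB.
  by rewrite /z opprB addrC subrK.
have ez' : psd (e - psi z).
  (* From 0 <= [psi z] <= 2 e, the operator [psi z] vanishes on the kernel of e, so its form at x
     equals its form at e x. That is at most |e x|^2, since [psi z] <= 1. *)
  move=> x; have z'q y : e y = 0 -> psi z y = 0.
    move=> ey; apply: (dominated_ker (u := 2 *: e)) => //.
      by apply: psdD => //; apply: psdZ => //; rewrite ler0n.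
    by rewrite bopZE ey scaler0.
  have zx : psi z x = psi z (e x).
    have /eqP : psi z (x - e x) = 0 by apply: z'q; rewrite linearB /= ide subrr.
    by rewrite linearB subr_eq0 => /eqP.
  rewrite bopBE hdotBl (projection_hdot _ pr) -hdot_norm.
  have -> : hdot (psi z x) x = hdot (psi z (e x)) (e x).
    by rewrite zx (psd_adjoint z'p) zx -(psd_adjoint z'p).
  by rewrite -hdotBl -[e x - _]/((bop_id H - psi z) (e x)).
have wu : psd (w - u).
  have -> : w - u = phi (1 *: e - psi z).
    rewrite (linear_onB opF phi_lin) // phiz scale1r zE -/u.
    by rewrite opprD addrA subrr add0r opprB.
  apply: (completely_positive1 phi_cp); first exact: opsysB.
  by rewrite scale1r.
split=> // x; have /eqP : w - u = 0 by apply: psd_opp; rewrite ?opprB.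
by rewrite subr_eq0 => /eqP wE'; rewrite -[u (u x)]/(w x) wE'.
Qed.

End IsoToCstar.

(** * Conclusion: a C*-algebra isomorphic to the tensor product has a corner isomorphic to E *)

Theorem corollary16 (R : realType) (H : hilbertType R) (E : set (bop H))
    (opsysE : operator_system E)
    (unitalE : E (bop_id H))
    (cpapE : CPAP E)
    (not_cstarE : ~ iso_to_cstar_algebra E) :
  CPAP (tensor_c0 E) /\ ~ iso_to_cstar_algebra (tensor_c0 E).
Proof.
split; first exact: tensor_c0_CPAP.
move=> [K [A [cstA [phi [psi [phi_lin phi_in psi_in phi_iso [phi_cp psi_cp]]]]]]].
have opF := tensor_c0_operator_system opsysE; have [opA _] := cstA.
pose v := l2_iso H 0; pose e := inflate v (bop_id H).
(* The unit of E places e in the tensor product. *)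
have Fe : tensor_c0 E e by exact: tensor_c0_inflate.
have pr : projection e by exact: range_projection.
have cutE T : cutdown e T = inflate v (compress v T) by exact: bop_ext.
have pu : projection (phi e).
  exact: (iso_projection opF cstA phi_lin phi_in psi_in phi_iso phi_cp psi_cp).
have psi_lin := iso_inverse_linear opF phi_lin phi_in psi_in.
have [Au psiu] := phi_in _ Fe.
have vF x : E x -> tensor_c0 E (inflate v x) by exact: tensor_c0_inflate.
have phiv x : E x -> corner A (phi e) (phi (inflate v x)).
  move=> Ex; split; first by have [] := phi_in _ (vF _ Ex).
  apply: (corner_map opF phi_lin phi_cp) => //; split; first exact: vF.
  by rewrite cutE inflateK.
(* [psi] is completely positive and sends [phi e] back to e, so it maps the corner of [phi e] into
   the corner of e, where inflating a compression changes nothing. *)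
have psiv y : corner A (phi e) y -> inflate v (compress v (psi y)) = psi y.
  have := corner_map opA psi_lin (x := y) psi_cp Au pu.
  by rewrite psiu -cutE; exact.
apply: not_cstarE; exists K, (corner A (phi e)); split; first exact: corner_cstar.
(* Inflation identifies E with the corner of e, and compression is its inverse there. *)
exists (phi \o inflate v), (compress v \o psi); split.
- move=> a x y Ex Ey; rewrite /= linearP phi_lin //; exact: vF.
- move=> x Ex; split; first exact: phiv.
  by rewrite /= (proj2 (phi_in _ (vF _ Ex))) inflateK.
- move=> y By; have [Ay _] := By; have [Fy phiy] := psi_in _ Ay.
  split; first exact: tensor_c0_compress.
  by rewrite /= psiv.
- move=> d a aE; rewrite map_mx_comp phi_iso ?mx_op_inflate ?inflate_norm //.
  by move=> i j; rewrite mxE; exact: vF.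
split=> d a aE ap; rewrite map_mx_comp.
  apply: phi_cp; first by move=> i j; rewrite mxE; exact: vF.
  by rewrite mx_op_inflate; exact: inflate_psd.
rewrite mx_op_compress; apply/compress_psd/psi_cp => //.
by move=> i j; have [] := aE i j.
Qed.
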